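(* For all integers $k\ge 1$, $h\ge 0$ and every real $\delta\ge 0$, \[ p^\delta_h\ \ge\ (1-2\delta)\left(\frac{\alpha_k}{2^k}\right)\alpha_k^{-h/k}, \qquad\text{and consequently}\qquad \mathrm{R}_\delta(\mathsf{3\text{-}MAJ}_h)\ \ge\ (1-2\delta)\left(\frac{\alpha_k}{2^k}\right)\left(2+\alpha_k^{-1/k}\right)^h . \]
   Context: Decision trees: a deterministic decision tree adaptively queries input bits and outputs a bit; a randomized decision tree algorithm is a distribution over deterministic ones, with cost on $x$ the expected number of queries and error on $x$ the probability of a wrong output. $\mathrm{R}_\delta(f)$ is the minimum over randomized algorithms with error $\le\delta$ on all inputs of the maximum cost over inputs. $\mathsf{3\text{-}MAJ}_h:\{0,1\}^{3^h}\to\{0,1\}$ is recursive majority-of-three on the complete ternary tree $T_h$ (leaves $1,\dots,3^h$ left to right; $\mathsf{3\text{-}MAJ}_0$ is the identity). Hard inputs: $\mathcal{H}_0=\{0,1\}$; for $h>0$, $\mathcal{H}_h$ is the set of $(x,y,z)\in\mathcal{H}_{h-1}^3$ whose three subformula values $\mathsf{3\text{-}MAJ}_{h-1}(x),\mathsf{3\text{-}MAJ}_{h-1}(y),\mathsf{3\text{-}MAJ}_{h-1}(z)$ are not all equal; $\mathcal{H}^0_h$ is the set of $x\in\mathcal{H}_h$ with $\mathsf{3\text{-}MAJ}_h(x)=0$. For $x\in\mathcal{H}_h$, the minority path starts at the root and repeatedly goes to the child whose value differs from its parent's; its leaf is the absolute minority $m(x)$. $p^\delta_h$ is the minimum, over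 randomized algorithms computing $\mathsf{3\text{-}MAJ}_h$ with error at most $\delta$, of the probability (over $x$ uniform in $\mathcal{H}_h$ and the algorithm's randomness) that the algorithm queries $x_{m(x)}$. Encoding: let $\mathcal{R}=\{0,1\}\times\{1,2,3\}$ and $c:\{0,1\}\times\mathcal{R}\to\{0,1\}^3$ be $c(y,(b,1))=(y,b,1-b)$, $c(y,(b,2))=(1-b,y,b)$, $c(y,(b,3))=(b,1-b,y)$. Let $\mathcal{R}^{(1)}_h=\mathcal{R}^{3^{h-1}}$ and $\mathcal{R}^{(k)}_h=\mathcal{R}^{(k-1)}_h\times\mathcal{R}^{3^{h-k}}$. For $h\ge1$, $y\in\mathcal{H}_{h-1}$, $r\in\mathcal{R}^{(1)}_h$, let $\psi^{(1)}(y,r)=x\in\mathcal{H}_h$ where $(x_{3i-2},x_{3i-1},x_{3i})=c(y_i,r_i)$ for $1\le i\le 3^{h-1}$. For $h\ge k>1$, $y\in\mathcal{H}_{h-k}$, $(R,r)\in\mathcal{R}^{(k)}_h$ (with $R\in\mathcal{R}^{(k-1)}_h$, $r\in\mathcal{R}^{3^{h-k}}$), let $\psi^{(k)}(y,(R,r))=\psi^{(k-1)}(\psi^{(1)}(y,r),R)$. Take $h=k$ and $\psi=\psi^{(k)}:\{0,1\}\times\mathcal{R}^{(k)}_k\to\mathcal{H}_k$; for each $r$ there is a unique index $q_1(r)\in\{1,\dots,3^k\}$ such that $\psi(y,r)_{q_1(r)}=y$ for both $y\in\{0,1\}$ (the position where the encoded bit is placed). For a deterministic decision tree $C$ on $3^k$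 variables that queries at least one variable, define \[ \alpha_C=\frac{\Pr_{x\in_R\mathcal{H}^0_k,\ (y,r)\in_R\psi^{-1}(x)}[C(x)\text{ queries }x_{q_1(r)}]}{\Pr_{x\in_R\mathcal{H}^0_k}[C(x)\text{ queries }x_{m(x)}]}, \] and $\alpha_k=\max_C\alpha_C$ over all such $C$. *)

(* Defs.v *)
From HB Require Import structures.
From mathcomp Require Import all_boot all_order all_algebra.
From mathcomp Require Import all_classical all_reals all_analysis.

Set Implicit Arguments.
Unset Strict Implicit.
Unset Printing Implicit Defensive.

Import Order.TTheory GRing.Theory Num.Theory.

Local Open Scope classical_set_scope.
Local Open Scope ring_scope.

(** * Decision trees *)

Definition input (n : nat) := {ffun 'I_n -> bool}.

(* [Query i t0 t1] queries variable [i] and continues with [t0] on answer 0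
   and with [t1] on answer 1. *)
Inductive dtree (n : nat) : Type :=
| Output of bool
| Query of 'I_n & dtree n & dtree n.

Fixpoint output (n : nat) (t : dtree n) (x : input n) : bool :=
  match t with
  | Output b => b
  | Query i t0 t1 => output (if x i then t1 else t0) x
  end.

Fixpoint queries (n : nat) (t : dtree n) (x : input n) : seq 'I_n :=
  match t with
  | Output _ => [::]
  | Query i t0 t1 => i :: queries (if x i then t1 else t0) x
  end.

Definition cost (n : nat) (t : dtree n) (x : input n) : nat :=
  size (queries t x).

(* The first query of a deterministic tree does not depend on the input, so a
   tree queries a variable on some input iff it does on every input. *)
Definition makes_query (n : nat) (t : dtree n) : bool :=
  if t is Query _ _ _ then true else false.

Fixpoint dtree_code (n : nat) (t : dtree n) : GenTree.tree ('I_n + bool) :=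
  match t with
  | Output b => GenTree.Leaf (inr b)
  | Query i t0 t1 =>
      GenTree.Node 0 [:: GenTree.Leaf (inl i); dtree_code t0; dtree_code t1]
  end.

Fixpoint dtree_decode (n : nat) (c : GenTree.tree ('I_n + bool)) :
    option (dtree n) :=
  match c with
  | GenTree.Leaf (inr b) => Some (Output n b)
  | GenTree.Node 0 [:: GenTree.Leaf (inl i); c0; c1] =>
      if (dtree_decode c0, dtree_decode c1) is (Some t0, Some t1)
      then Some (Query i t0 t1) else None
  | _ => None
  end.

Lemma dtree_codeK (n : nat) : pcancel (@dtree_code n) (@dtree_decode n).
Proof. by elim=> [b|i t0 IH0 t1 IH1] //=; rewrite IH0 IH1. Qed.

(* [dtree n] is countable and carries the discrete sigma-algebra, so that a
   [probability (dtree n) R] is an arbitrary distribution on decision trees. *)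
HB.instance Definition _ (n : nat) :=
  Countable.copy (dtree n) (pcan_type (@dtree_codeK n)).
HB.instance Definition _ (n : nat) := isPointed.Build (dtree n) (Output n false).
HB.instance Definition _ (n : nat) :=
  @isMeasurable.Build default_measure_display (dtree n)
    discrete_measurable discrete_measurable0
    discrete_measurableC discrete_measurableU.

Definition randomized (R : realType) (n : nat) := probability (dtree n) R.

Definition computes_with_error (R : realType) (n : nat) (P : randomized R n)
    (f : input n -> bool) (delta : R) : Prop :=
  forall x : input n, (P [set t | output t x != f x] <= delta%:E)%E.

Definition max_cost (R : realType) (n : nat) (P : randomized R n) : \bar R :=
  \big[maxe/-oo%E]_(x : input n) 'E_P[fun t => (cost t x)%:R]%E.

(* Extended-real valued because an arbitrary distribution on trees may have an
   infinite expected cost.  The infimum is attained: discarding repeated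
   queries leaves finitely many trees. *)
Definition rand_complexity (R : realType) (n : nat) (delta : R)
    (f : input n -> bool) : \bar R :=
  ereal_inf [set max_cost P
            | P in [set P : randomized R n | computes_with_error P f delta]].

(** * Recursive majority of three; leaves are numbered from 0 *)

Definition inp (h : nat) := input (3 ^ h).

Lemma leaf0_subproof (h : nat) : (0 < 3 ^ h)%N.
Proof. by rewrite expn_gt0. Qed.

Definition leaf0 (h : nat) : 'I_(3 ^ h) := Ordinal (leaf0_subproof h).

Lemma subleaf_subproof (h : nat) (j : 'I_3) (i : 'I_(3 ^ h)) :
  (j * 3 ^ h + i < 3 ^ h.+1)%N.
Proof.
rewrite expnS (@leq_trans (j * 3 ^ h + 3 ^ h)%N) ?ltn_add2l//.
by rewrite -mulSnr leq_mul2r ltn_ord orbT.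
Qed.

(* Leaf [i] of the [j]-th child of the root of the tree of height [h.+1]. *)
Definition subleaf (h : nat) (j : 'I_3) (i : 'I_(3 ^ h)) : 'I_(3 ^ h.+1) :=
  Ordinal (subleaf_subproof j i).

Definition subinp (h : nat) (x : inp h.+1) (j : 'I_3) : inp h :=
  [ffun i => x (subleaf j i)].

Definition maj3 (a b c : bool) : bool := [|| a && b, a && c | b && c].

Definition child0 : 'I_3 := @Ordinal 3 0 isT.
Definition child1 : 'I_3 := @Ordinal 3 1 isT.
Definition child2 : 'I_3 := @Ordinal 3 2 isT.

Fixpoint maj (h : nat) : inp h -> bool :=
  match h with
  | 0 => fun x => x (leaf0 0)
  | h'.+1 => fun x => maj3 (maj (subinp x child0)) (maj (subinp x child1))
                           (maj (subinp x child2))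
  end.

Fixpoint hard (h : nat) : inp h -> bool :=
  match h with
  | 0 => fun _ => true
  | h'.+1 => fun x =>
      [forall j : 'I_3, hard (subinp x j)] &&
      ~~ [forall j : 'I_3, forall j' : 'I_3,
            maj (subinp x j) == maj (subinp x j')]
  end.

Definition hard_inputs (h : nat) : {set inp h} := [set x | hard x]%SET.

Definition hard_inputs0 (h : nat) : {set inp h} :=
  [set x in hard_inputs h | maj x == false]%SET.

(* On hard inputs exactly one child of every node of the path satisfies the
   predicate of [pick]; the default is only reached on other inputs. *)
Fixpoint minority (h : nat) : inp h -> 'I_(3 ^ h) :=
  match h with
  | 0 => fun _ => leaf0 0
  | h'.+1 => fun x =>
      let j := odflt child0 [pick j : 'I_3 | maj (subinp x j) != maj x] in
      subleaf j (minority (subinp x j))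
  end.

(* Expectation of [F] under the uniform distribution on [A]. *)
Definition unif_mean (R : realType) (T : finType) (A : {set T}) (F : T -> R) : R :=
  (\sum_(x in A) F x) / #|A|%:R.

Definition minority_query_prob (R : realType) (h : nat)
    (P : randomized R (3 ^ h)) : \bar R :=
  'E_P[fun t => unif_mean (hard_inputs h)
                  (fun x => (minority x \in queries t x)%:R)]%E.

(* As for [rand_complexity], the infimum is attained. *)
Definition min_minority_query_prob (R : realType) (h : nat) (delta : R) : \bar R :=
  ereal_inf [set minority_query_prob P
            | P in [set P : randomized R (3 ^ h)
                   | computes_with_error P (@maj h) delta]].

(** * The encoding *)

Definition letter := (bool * 'I_3)%type.

Definition encode_bit (y : bool) (r : letter) : 3.-tuple bool :=
  let: (b, i) := r in
  match val i with
  | 0 => [tuple y; b; ~~ b]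
  | 1 => [tuple ~~ b; y; b]
  | _ => [tuple b; ~~ b; y]
  end.

Lemma parent_subproof (d : nat) (q : 'I_(3 ^ d.+1)) : (q %/ 3 < 3 ^ d)%N.
Proof. by rewrite ltn_divLR// -expnSr. Qed.

Definition parent (d : nat) (q : 'I_(3 ^ d.+1)) : 'I_(3 ^ d) :=
  Ordinal (parent_subproof q).

Definition child_pos (d : nat) (q : 'I_(3 ^ d.+1)) : 'I_3 :=
  Ordinal (ltn_pmod q (isT : 0 < 3)%N).

Definition psi1 (d : nat) (y : inp d) (r : {ffun 'I_(3 ^ d) -> letter}) : inp d.+1 :=
  [ffun q => tnth (encode_bit (y (parent q)) (r (parent q))) (child_pos q)].

(* [enc_rand k d] is the randomness of the [k]-step encoding of inputs of height
   [d] into inputs of height [h = k + d]; the recursion is started at [k = 0]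
   with a trivial component, hence [enc_rand 1 d = unit * letter ^ (3 ^ d)]. *)
Fixpoint enc_rand (k d : nat) : finType :=
  match k with
  | 0 => unit
  | k'.+1 => (enc_rand k' d.+1 * {ffun 'I_(3 ^ d) -> letter})%type
  end.

Fixpoint psi (k d h : nat) : (k + d)%N = h -> inp d -> enc_rand k d -> inp h :=
  match k with
  | 0 => fun e y _ => ecast n (inp n) e y
  | k'.+1 => fun e y Rr =>
      @psi k' d.+1 h (etrans (addnS k' d) e) (psi1 y Rr.2) Rr.1
  end.

Definition encode (k : nat) (y : bool) (r : enc_rand k 0) : inp k :=
  psi (addn0 k) ([ffun=> y] : inp 0) r.

(* The default is never reached. *)
Definition encoded_pos (k : nat) (r : enc_rand k 0) : 'I_(3 ^ k) :=
  odflt (leaf0 k) [pick q | [forall y : bool, encode y r q == y]].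

Definition encodings (k : nat) (x : inp k) : {set bool * enc_rand k 0} :=
  [set yr | encode yr.1 yr.2 == x]%SET.

Definition alpha_of (R : realType) (k : nat) (C : dtree (3 ^ k)) : R :=
  unif_mean (hard_inputs0 k)
    (fun x => unif_mean (encodings x)
       (fun yr => (encoded_pos yr.2 \in queries C x)%:R))
  / unif_mean (hard_inputs0 k) (fun x => (minority x \in queries C x)%:R).

(* [alpha_of R C] takes finitely many values, so the supremum is a maximum. *)
Definition alpha (R : realType) (k : nat) : R :=
  sup [set alpha_of R C | C in [set C : dtree (3 ^ k) | makes_query C]].

(* Main.v *)
(* Everything happens for one deterministic tree [t] of height [h] on a uniform
   hard input: the claim is that the probability of querying the absolute minority
   is at least [c_h (1 - 2 e)], with [e] the error probability of [t]; integrating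
   over [t] gives the bound on randomized algorithms.  For [h = 0] a tree that
   queries nothing errs on exactly one of the two inputs, so [c_0 = 1].  An encoding
   of hard inputs of height [d] into hard inputs of height [h], hit uniformly, turns
   a tree of height [h] into a random tree of height [d] with the same average
   error, hence transports the bound, divided by the largest ratio of the
   probability of querying the encoded minority bit to that of querying the minority.
   Encoding every leaf by [psi] divides the bound by [alpha_k]: conditionally on
   the other subtrees, the subtree of height [k] of the minority path is a uniform
   hard input on which [t] acts as a tree of height [k], for which the ratio is at
   most [alpha_k] by definition (for the value 1, after exchanging the values 0 and
   1).  For [k = 1] the ratio is at most 2 by inspection of trees on three bits, and
   composing one-level encodings gives [alpha_k <= 2^k], which handles the heights
   that are not multiples of [k].

   For the second bound, let [B_d] be the expected number of queried leaves under the
   node of depth [d] of the minority path, so that [B_h] is the probability above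
   and [B_0] bounds the cost from below.  Among the leaves counted by [B_d] but not
   by [B_(d+1)], half lie under a random majority child, and inserting a majority
   level at depth [d] is an encoding into height [h + 1] of the inputs of height [h];
   so [B_d] at height [h + 1] is at least [B_(d+1)] at height [h + 1] plus twice the
   bound for [B_d] at height [h], whence the factor [2 + alpha_k^(-1/k)] per level. *)

Require Import Defs.
From mathcomp Require Import all_boot all_order all_algebra.
From mathcomp Require Import all_classical all_reals all_analysis.
From mathcomp Require Import ring lra.

Set Implicit Arguments.
Unset Strict Implicit.
Unset Printing Implicit Defensive.

Import Order.TTheory GRing.Theory Num.Theory.

Local Open Scope ring_scope.

(** * Substitutions in decision trees *)

Section Restriction.
Variables n m : nat.
Implicit Types (s : 'I_n -> 'I_m + bool) (t : dtree n) (y : input m).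

(** Once its randomness is fixed, an encoding sets each variable to a constant ([inr]) or copies a
    variable of the shorter input into it ([inl]). Composing a tree with it therefore gives a tree
    again, namely [dtree_subst]. *)
Definition subst s y : input n :=
  [ffun i => match s i with inl q => y q | inr b => b end].

Fixpoint dtree_subst s t : dtree m :=
  match t with
  | Output b => Output m b
  | Query i t0 t1 =>
      match s i with
      | inl q => Query q (dtree_subst s t0) (dtree_subst s t1)
      | inr b => dtree_subst s (if b then t1 else t0)
      end
  end.

Lemma output_dtree_subst s t y :
  output (dtree_subst s t) y = output t (subst s y).
Proof.
elim: t => [b|i t0 IH0 t1 IH1] //=.
rewrite ffunE; case: (s i) => [q|b] /=; first by case: (y q).
by case: b.
Qed.

Lemma mem_queries_dtree_subst s t y q :
  (q \in queries (dtree_subst s t) y)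
  = has (fun i => s i == inl q) (queries t (subst s y)).
Proof.
elim: t => [b|i t0 IH0 t1 IH1] //=.
rewrite ffunE; case: (s i) => [p|b] /=.
  by rewrite inE [inl p == _]/eq_op/= eq_sym; case: (y p); rewrite ?IH0 ?IH1.
by case: b; rewrite ?IH0 ?IH1.
Qed.

End Restriction.

Definition subst_comp (n m l : nat) (s : 'I_m -> 'I_l + bool)
    (s' : 'I_n -> 'I_m + bool) (i : 'I_n) : 'I_l + bool :=
  match s' i with inl q => s q | inr b => inr b end.

Lemma dtree_subst_comp (n m l : nat) (s : 'I_m -> 'I_l + bool)
    (s' : 'I_n -> 'I_m + bool) (t : dtree n) :
  dtree_subst s (dtree_subst s' t) = dtree_subst (subst_comp s s') t.
Proof.
elim: t => [b|i t0 IH0 t1 IH1] //=.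
rewrite /subst_comp; case: (s' i) => [q|b] /=; last by case: b.
by rewrite -/(subst_comp s s') -IH0 -IH1; case: (s q) => // -[].
Qed.

Lemma subst_subst (n m l : nat) (s : 'I_m -> 'I_l + bool)
    (s' : 'I_n -> 'I_m + bool) (y : input l) :
  subst s' (subst s y) = subst (subst_comp s s') y.
Proof.
by apply/ffunP => i; rewrite !ffunE /subst_comp; case: (s' i) => // q; rewrite ffunE.
Qed.

(** * Inputs as triples of subinputs *)

Section Blocks.
Variable h : nat.

Lemma block_subproof (i : 'I_(3 ^ h.+1)) : (i %/ 3 ^ h < 3)%N.
Proof. by rewrite ltn_divLR ?expn_gt0// -expnS ltn_ord. Qed.

Definition block (i : 'I_(3 ^ h.+1)) : 'I_3 := Ordinal (block_subproof i).

Lemma inner_subproof (i : 'I_(3 ^ h.+1)) : (i %% 3 ^ h < 3 ^ h)%N.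
Proof. by rewrite ltn_mod expn_gt0. Qed.

Definition inner (i : 'I_(3 ^ h.+1)) : 'I_(3 ^ h) := Ordinal (inner_subproof i).

Lemma block_subleaf (j : 'I_3) (i : 'I_(3 ^ h)) : block (subleaf j i) = j.
Proof. by apply: val_inj; rewrite /= divnMDl ?expn_gt0// divn_small ?addn0. Qed.

Lemma inner_subleaf (j : 'I_3) (i : 'I_(3 ^ h)) : inner (subleaf j i) = i.
Proof. by apply: val_inj; rewrite /= modnMDl modn_small. Qed.

Lemma subleafK (i : 'I_(3 ^ h.+1)) : subleaf (block i) (inner i) = i.
Proof. by apply: val_inj; rewrite /= -divn_eq. Qed.

Lemma subleaf_eq (j j' : 'I_3) (i i' : 'I_(3 ^ h)) :
  (subleaf j i == subleaf j' i') = (j == j') && (i == i').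
Proof.
apply/eqP/andP => [e|[/eqP -> /eqP ->]//].
move: (congr1 (@block) e) (congr1 (@inner) e).
by rewrite !block_subleaf !inner_subleaf => -> ->.
Qed.

Variable A : finType.

Definition join (g : {ffun 'I_3 -> {ffun 'I_(3 ^ h) -> A}}) :
  {ffun 'I_(3 ^ h.+1) -> A} := [ffun i => g (block i) (inner i)].

Definition split_blocks (x : {ffun 'I_(3 ^ h.+1) -> A}) :
    {ffun 'I_3 -> {ffun 'I_(3 ^ h) -> A}} :=
  [ffun j => [ffun i => x (subleaf j i)]].

Lemma joinK : cancel join split_blocks.
Proof.
move=> g; apply/ffunP => j; apply/ffunP => i.
by rewrite !ffunE block_subleaf inner_subleaf.
Qed.

Lemma split_blocksK : cancel split_blocks join.
Proof. by move=> x; apply/ffunP => i; rewrite !ffunE subleafK. Qed.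

Lemma join_bij : bijective join.
Proof. exact: Bijective joinK split_blocksK. Qed.

End Blocks.

Section Triples.
Variable X : finType.

(* Addition in ['I_3] is modulo 3. *)
Definition triple (j : 'I_3) (w u v : X) : {ffun 'I_3 -> X} :=
  [ffun i => if i == j then w else if i == j + 1 then u else v].

Lemma tripleE (j : 'I_3) (w u v : X) :
  [/\ triple j w u v j = w, triple j w u v (j + 1) = u
    & triple j w u v (j + 2) = v].
Proof.
rewrite !ffunE eqxx; split => //.
  by rewrite eqxx; case: j => -[|[|[|]]].
by case: j => -[|[|[|]]].
Qed.

Lemma triple_surj (j : 'I_3) (g : {ffun 'I_3 -> X}) :
  g = triple j (g j) (g (j + 1)) (g (j + 2)).
Proof.
apply/ffunP => i; rewrite ffunE.
case: eqP => [->//|/eqP ni]; case: eqP => [->//|/eqP ni'].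
congr (g _); apply/eqP; move: ni ni'.
by case: j => -[|[|[|]]] // ?; case: i => -[|[|[|]]].
Qed.

Lemma sum_triple (V : nmodType) (j : 'I_3) (F : {ffun 'I_3 -> X} -> V) :
  \sum_g F g = \sum_w \sum_u \sum_v F (triple j w u v).
Proof.
rewrite pair_big pair_big /=.
rewrite (reindex (fun p : X * X * X => triple j p.1.1 p.1.2 p.2)) //=.
exists (fun g : {ffun 'I_3 -> X} => (g j, g (j + 1), g (j + 2)))
  => [[[w u] v] _|g _] /=.
  by have [-> -> ->] := tripleE j w u v.
by rewrite -triple_surj.
Qed.

End Triples.

Lemma ord3_cases (j i : 'I_3) : [\/ i = j, i = j + 1 | i = j + 2].
Proof.
case: (i =P j) => [->|/eqP n1]; first by constructor.
case: (i =P j + 1) => [->|/eqP n2]; first by constructor.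
constructor 3; apply/eqP; move: n1 n2.
by case: j => -[|[|[|]]] // ?; case: i => -[|[|[|]]].
Qed.

Definition arr h (j : 'I_3) (w u v : inp h) : inp h.+1 := join (triple j w u v).

Lemma subinp_join h (g : {ffun 'I_3 -> inp h}) j : subinp (join g) j = g j.
Proof. by have /ffunP/(_ j) := joinK g; rewrite ffunE. Qed.

Lemma subinp_arr h (j : 'I_3) (w u v : inp h) :
  [/\ subinp (arr j w u v) j = w, subinp (arr j w u v) (j + 1) = u
    & subinp (arr j w u v) (j + 2) = v].
Proof. by rewrite /arr !subinp_join; apply: tripleE. Qed.

Lemma sum_arr (V : nmodType) h (j : 'I_3) (F : inp h.+1 -> V) :
  \sum_x F x = \sum_w \sum_u \sum_v F (arr j w u v).
Proof. by rewrite (reindex _ (onW_bij _ (@join_bij h bool))) (sum_triple j). Qed.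

Definition hard_val h (b : bool) (x : inp h) : bool := hard x && (maj x == b).

Lemma maj_arr h (j : 'I_3) (w u v : inp h) :
  maj (arr j w u v) = maj3 (maj w) (maj u) (maj v).
Proof.
rewrite /arr /= !subinp_join !ffunE /maj3.
by case: j => -[|[|[|]]] //= ?; case: (maj w); case: (maj u); case: (maj v).
Qed.

Lemma forall_ord3 (j : 'I_3) (P : pred 'I_3) :
  [forall i, P i] = [&& P j, P (j + 1) & P (j + 2)].
Proof.
apply/forallP/and3P => [H|[p0 p1 p2] i]; first by split.
by have [->|->|->] := ord3_cases j i.
Qed.

Lemma hard_arr h (j : 'I_3) (w u v : inp h) :
  hard (arr j w u v)
  = [&& hard w, hard u & hard v] && ~~ ((maj w == maj u) && (maj u == maj v)).
Proof.
have [e0 e1 e2] := subinp_arr j w u v.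
rewrite [hard _]/= !(forall_ord3 j) e0 e1 e2; congr (_ && ~~ _).
by case: (maj w); case: (maj u); case: (maj v).
Qed.

Lemma hard_val_arr h b (j : 'I_3) (w u v : inp h) :
  maj w = ~~ b ->
  hard_val b (arr j w u v) = [&& hard_val (~~ b) w, hard_val b u & hard_val b v].
Proof.
rewrite /hard_val hard_arr maj_arr => ->.
by case: (hard w); case: (hard u); case: (hard v); case: b;
   case: (maj u); case: (maj v).
Qed.

Lemma hard_val_arr_maj h b (j : 'I_3) (w u v : inp h) :
  maj w = b ->
  hard_val b (arr j w u v)
  = [&& hard_val b w, hard u, hard v & maj u != maj v].
Proof.
rewrite /hard_val hard_arr maj_arr => ->.
by case: (hard w); case: (hard u); case: (hard v); case: b;
   case: (maj u); case: (maj v).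
Qed.

Lemma minority_arr h b (j : 'I_3) (w u v : inp h) :
  maj w = ~~ b -> maj u = b -> maj v = b ->
  minority (arr j w u v) = subleaf j (minority w).
Proof.
move=> ew eu ev; have [e0 e1 e2] := subinp_arr j w u v.
have em : maj (arr j w u v) = b by rewrite maj_arr ew eu ev; case: b {ew eu ev}.
set x := arr j w u v in e0 e1 e2 em *.
pose o := odflt child0 [pick j' | maj (subinp x j') != maj x].
have -> : minority x = subleaf o (minority (subinp x o)) by [].
suff -> : o = j by rewrite e0.
rewrite /o; case: pickP => [i|/(_ j)]; rewrite em; last by rewrite e0 ew; case: (b).
by have [->|->|->] := ord3_cases j i; rewrite ?e1 ?e2 ?eu ?ev ?eqxx.
Qed.

(** * Sums over hard inputs, by the minority child or by a marked majority child *)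

Section HardSums.
Variable V : nmodType.

Lemma sum_arr_cond h (j : 'I_3) (P : pred (inp h.+1)) (Pw Pu Pv : pred (inp h))
    (F : inp h.+1 -> V) :
  (forall w u v, P (arr j w u v) = [&& Pw w, Pu u & Pv v]) ->
  \sum_(x | P x) F x
  = \sum_(w | Pw w) \sum_(u | Pu u) \sum_(v | Pv v) F (arr j w u v).
Proof.
move=> PE; rewrite big_mkcond (sum_arr j) [RHS]big_mkcond /=.
apply: eq_bigr => w _; case: (boolP (Pw w)) => Hw; last first.
  by rewrite big1 // => u _; rewrite big1 // => v _; rewrite PE (negbTE Hw).
rewrite [RHS]big_mkcond; apply: eq_bigr => u _; case: (boolP (Pu u)) => Hu; last first.
  by rewrite big1 // => v _; rewrite PE (negbTE Hu) andbF.
by rewrite [RHS]big_mkcond; apply: eq_bigr => v _; rewrite PE Hw Hu.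
Qed.

Lemma sum_ord3 (F : 'I_3 -> V) : \sum_j F j = F 0 + (F (0 + 1) + F (0 + 2)).
Proof.
rewrite big_ord_recl big_ord_recl big_ord_recl big_ord0 addr0.
by congr (_ + (F _ + F _)); apply: val_inj.
Qed.

(** A hard input has exactly one minority child. The form of a sum of a constant allows the choice
    of that child to be inserted in any sum over hard inputs. *)
Lemma sum_minority_child h (b : bool) (x : inp h.+1) (c : V) :
  hard_val b x -> \sum_(j | maj (subinp x j) == ~~ b) c = c.
Proof.
pose f := split_blocks x.
have -> : x = arr 0 (f 0) (f (0 + 1)) (f (0 + 2)).
  by rewrite /arr -triple_surj split_blocksK.
move: (f 0) (f (0 + 1)) (f (0 + 2)) => w u v; have [e0 e1 e2] := subinp_arr 0 w u v.
rewrite /hard_val hard_arr maj_arr => H.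
rewrite big_mkcond sum_ord3 e0 e1 e2.
move: H; case: (maj w); case: (maj u); case: (maj v); case: b;
  by rewrite ?andbF //= ?addr0 ?add0r.
Qed.

Lemma sum_hard_val h (b : bool) (F : inp h.+1 -> V) :
  \sum_(x | hard_val b x) F x
  = \sum_j \sum_(w | hard_val (~~ b) w) \sum_(u | hard_val b u)
      \sum_(v | hard_val b v) F (arr j w u v).
Proof.
under eq_bigr => x Hx do rewrite -(sum_minority_child (F x) Hx).
rewrite (exchange_big_dep predT) //=; apply: eq_bigr => j _.
apply: sum_arr_cond => w u v; have [-> _ _] := subinp_arr j w u v.
case: (maj w =P ~~ b) => [e|/eqP ne]; first by rewrite andbT hard_val_arr.
by rewrite andbF /hard_val (negbTE ne) andbF.
Qed.

(** Once a majority child [j] is marked, the other two children have opposite values, [c] being that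
    of child [j + 1], while the marked child is any hard input of value [b]. *)
Lemma sum_hard_majority h (b : bool) (G : 'I_3 -> inp h.+1 -> V) :
  \sum_(x | hard_val b x) \sum_(j | maj (subinp x j) == b) G j x
  = \sum_j \sum_(w | hard_val b w) \sum_c \sum_(u | hard_val c u)
      \sum_(v | hard_val (~~ c) v) G j (arr j w u v).
Proof.
rewrite (exchange_big_dep predT) //=; apply: eq_bigr => j _.
under [RHS]eq_bigr do rewrite big_bool /=.
rewrite big_split /=.
rewrite (bigID (fun x : inp h.+1 => maj (subinp x (j + 1)) == true)) /=.
congr (_ + _); apply: sum_arr_cond => w u v; have [-> -> _] := subinp_arr j w u v;
  (case: (maj w =P b) => [e|/eqP ne];
     last by rewrite andbF /hard_val (negbTE ne) andbF);
  rewrite andbT (hard_val_arr_maj _ _ _ e) /hard_val;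
  by case: (hard w); case: (hard u); case: (hard v); rewrite ?andbF //= ?andbT;
     case: (maj u); case: (maj v); rewrite ?andbF ?andbT.
Qed.

End HardSums.

(** * Encoders and their lifting to three subtrees *)

Definition lift_sub e e' (Om : finType) (s : Om -> 'I_(3 ^ e') -> 'I_(3 ^ e) + bool)
    (g : {ffun 'I_3 -> Om}) (i : 'I_(3 ^ e'.+1)) : 'I_(3 ^ e.+1) + bool :=
  match s (g (block i)) (inner i) with
  | inl q => inl (subleaf (block i) q)
  | inr b => inr b
  end.

Lemma subinp_lift_sub e e' (Om : finType) (s : Om -> 'I_(3 ^ e') -> 'I_(3 ^ e) + bool)
    (g : {ffun 'I_3 -> Om}) (y : inp e.+1) j :
  subinp (subst (lift_sub s g) y) j = subst (s (g j)) (subinp y j).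
Proof.
apply/ffunP => i; rewrite !ffunE /lift_sub block_subleaf inner_subleaf.
by case: (s _ _) => // q; rewrite ffunE.
Qed.

Lemma split_blocks_triple h (x : inp h.+1) j :
  x = arr j (subinp x j) (subinp x (j + 1)) (subinp x (j + 2)).
Proof.
by rewrite -[LHS]split_blocksK {1}(triple_surj j (split_blocks x)) !ffunE.
Qed.

Lemma subst_lift_sub e e' (Om : finType) (s : Om -> 'I_(3 ^ e') -> 'I_(3 ^ e) + bool)
    (j : 'I_3) (a b c : Om) (w u v : inp e) :
  subst (lift_sub s (triple j a b c)) (arr j w u v)
  = arr j (subst (s a) w) (subst (s b) u) (subst (s c) v).
Proof.
have [e0 e1 e2] := subinp_arr j w u v; have [f0 f1 f2] := tripleE j a b c.
by rewrite [LHS](split_blocks_triple _ j) !subinp_lift_sub e0 e1 e2 f0 f1 f2.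
Qed.

(** Freezing the siblings of child [j] turns a tree of height [h.+1] into one of height [h]. The
    first [u] given to [arr] is a dummy: block [j] holds the variables. *)
Definition block_sub h (j : 'I_3) (u v : inp h) (i : 'I_(3 ^ h.+1)) :
    'I_(3 ^ h) + bool :=
  if block i == j then inl (inner i) else inr (arr j u u v i).

Lemma subst_block_sub h (j : 'I_3) (w u v : inp h) :
  subst (block_sub j u v) w = arr j w u v.
Proof.
apply/ffunP => i; rewrite !ffunE /block_sub; case: (block i =P j) => // nj.
by rewrite !ffunE; case: eqP nj.
Qed.

Lemma mem_queries_block_sub h (j : 'I_3) (w u v : inp h) t q :
  (q \in queries (dtree_subst (block_sub j u v) t) w)
  = (subleaf j q \in queries t (arr j w u v)).
Proof.
rewrite mem_queries_dtree_subst subst_block_sub -has_pred1; apply: eq_has => i.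
by rewrite [RHS]/= -[i in RHS]subleafK subleaf_eq /= /block_sub; case: (block i == j).
Qed.

(** Encoding the three children and then freezing two of them amounts to freezing these two at their
    encodings and encoding the third. Hence a lifted encoding, seen from one child, is the original
    one applied to a restricted tree. *)
Lemma subst_comp_block_lift e e' (Om : finType)
    (s : Om -> 'I_(3 ^ e') -> 'I_(3 ^ e) + bool)
    (j : 'I_3) (a b c : Om) (u v : inp e) :
  subst_comp (block_sub j u v) (lift_sub s (triple j a b c))
  = subst_comp (s a) (block_sub j (subst (s b) u) (subst (s c) v)).
Proof.
apply: funext => i; rewrite /subst_comp /lift_sub /block_sub !ffunE.
case: (block i =P j) => [->|/eqP/negbTE nj].
  by case: (s _ _) => // q; rewrite block_subleaf eqxx inner_subleaf.
case E: (block i == j + 1); rewrite !ffunE; case: (s _ _) => // q;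
  by rewrite block_subleaf !ffunE block_subleaf inner_subleaf nj E.
Qed.

Section Encoders.
Variable R : realType.

Definition stat h := dtree (3 ^ h) -> inp h -> R.

(** By [sum_encoder], every hard input of value [b] comes from exactly [kappa] pairs of a hard input
    of value [b] and a code, so a uniform pair yields a uniform hard input. Stating it for sums
    makes lifting and composition exchanges of sums. *)
Record encoder e e' (Om : finType) (s : Om -> 'I_(3 ^ e') -> 'I_(3 ^ e) + bool)
    (kappa : R) : Prop := Encoder {
  encoder_gt0 : 0 < kappa;
  maj_encoder : forall om z, maj (subst (s om) z) = maj z;
  sum_encoder : forall b (F : inp e' -> R),
    \sum_(z | hard_val b z) \sum_om F (subst (s om) z)
    = kappa * \sum_(x | hard_val b x) F x }.

(** The factor [kappa] is the normalization of [sum_encoder], so [a] bounds the ratio of the two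
    averages. Each value [b] is treated apart, since passing to the minority child exchanges the
    values. *)
Definition dominated e e' (Om : finType)
    (s : Om -> 'I_(3 ^ e') -> 'I_(3 ^ e) + bool) (kappa a : R)
    (S : stat e) (S' : stat e') : Prop :=
  forall t b, \sum_(z | hard_val b z) \sum_om S (dtree_subst (s om) t) z
              <= a * kappa * \sum_(x | hard_val b x) S' t x.

Definition reduction e e' (a : R) (S : stat e) (S' : stat e') : Prop :=
  exists (Om : finType) (s : Om -> 'I_(3 ^ e') -> 'I_(3 ^ e) + bool) kappa,
    encoder s kappa /\ dominated s kappa a S S'.

(** Such a statistic sees only the minority child, through the tree obtained by freezing the other
    two. *)
Definition lifts h (S : stat h) (S' : stat h.+1) : Prop :=
  forall t b j w u v, maj w = ~~ b -> maj u = b -> maj v = b ->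
    S' t (arr j w u v) = S (dtree_subst (block_sub j u v) t) w.

Section Lift.
Variables (e e' : nat) (Om : finType).
Variables (s : Om -> 'I_(3 ^ e') -> 'I_(3 ^ e) + bool) (kappa a : R).
Hypothesis enc : encoder s kappa.

Lemma sum_encoder2 b c (F : inp e' -> inp e' -> R) :
  \sum_(u | hard_val b u) \sum_(v | hard_val c v) \sum_o \sum_o'
     F (subst (s o) u) (subst (s o') v)
  = kappa ^+ 2 * \sum_(u | hard_val b u) \sum_(v | hard_val c v) F u v.
Proof.
under eq_bigr => u _.
  rewrite exchange_big /=.
  under eq_bigr => o _ do rewrite (sum_encoder enc c).
  over.
by rewrite (sum_encoder enc b (fun u => kappa * \sum_(v | _) F u v)) -mulr_sumr mulrA.
Qed.

(** The children are encoded independently, whence the cube. Their values are preserved, so the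
    minority child stays at position [j]. *)
Lemma encoder_lift : encoder (lift_sub s) (kappa ^+ 3).
Proof.
split; first by rewrite exprn_gt0 // (encoder_gt0 enc).
  move=> om z; rewrite [z](split_blocks_triple _ 0) (triple_surj 0 om).
  by rewrite subst_lift_sub !maj_arr !(maj_encoder enc).
move=> b F; rewrite !sum_hard_val mulr_sumr; apply: eq_bigr => j _.
under eq_bigr => w _ do under eq_bigr => u _ do under eq_bigr => v _ do
  (rewrite (sum_triple j); under eq_bigr => o _ do under eq_bigr => o' _ do
   under eq_bigr => o'' _ do rewrite subst_lift_sub).
under eq_bigr => w _.
  under eq_bigr => u _ do rewrite exchange_big /=.
  rewrite exchange_big /=.
  under eq_bigr => o _ do
    rewrite (sum_encoder2 b b (fun u v => F (arr j (subst (s o) w) u v))).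
  over.
rewrite (sum_encoder enc (~~ b) (fun w => kappa ^+ 2 * \sum_(u | hard_val b u)
  \sum_(v | hard_val b v) F (arr j w u v))).
by rewrite -mulr_sumr mulrA -exprS.
Qed.

(* Conditionally on the other two children, the minority child is uniform among the
   hard inputs of the opposite value, so the ratio [a] is unchanged. *)
Lemma dominated_lift (S : stat e) (S' : stat e') (S1 : stat e.+1)
    (S1' : stat e'.+1) :
  lifts S S1 -> lifts S' S1' -> dominated s kappa a S S' ->
  dominated (lift_sub s) (kappa ^+ 3) a S1 S1'.
Proof.
move=> LS LS' D t b; rewrite !sum_hard_val mulr_sumr; apply: ler_sum => j _.
pose T u v := dtree_subst (block_sub j u v) t.
have -> : \sum_(w | hard_val (~~ b) w) \sum_(u | hard_val b u)
    \sum_(v | hard_val b v) \sum_om S1 (dtree_subst (lift_sub s om) t) (arr j w u v)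
  = \sum_(u | hard_val b u) \sum_(v | hard_val b v) \sum_o' \sum_o''
      \sum_(w | hard_val (~~ b) w) \sum_o
        S (dtree_subst (s o) (T (subst (s o') u) (subst (s o'') v))) w.
  rewrite exchange_big; apply: eq_bigr => u /andP[_ /eqP mu].
  rewrite exchange_big; apply: eq_bigr => v /andP[_ /eqP mv].
  transitivity (\sum_(w | hard_val (~~ b) w) \sum_o' \sum_o'' \sum_o
        S (dtree_subst (s o) (T (subst (s o') u) (subst (s o'') v))) w).
    apply: eq_bigr => w /andP[_ /eqP mw]; rewrite (sum_triple j) exchange_big.
    apply: eq_bigr => o' _; rewrite exchange_big.
    apply: eq_bigr => o'' _; apply: eq_bigr => o _.
    by rewrite (LS _ b) // dtree_subst_comp subst_comp_block_lift -dtree_subst_comp.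
  rewrite exchange_big; apply: eq_bigr => o' _.
  by rewrite exchange_big.
(* The hypothesis is used at the value [~~ b] for each choice of the siblings and their codes;
   summing over these then costs the factor [kappa ^+ 2]. *)
apply: (@le_trans _ _ (\sum_(u | hard_val b u) \sum_(v | hard_val b v)
    \sum_o' \sum_o'' a * kappa * \sum_(x | hard_val (~~ b) x)
        S' (T (subst (s o') u) (subst (s o'') v)) x)).
  do 2 (apply: ler_sum => ? _); do 2 (apply: ler_sum => ? _); exact: D.
rewrite (sum_encoder2 b b (fun u v => a * kappa * \sum_(x | hard_val (~~ b) x)
  S' (T u v) x)).
rewrite le_eqVlt; apply/orP; left; apply/eqP.
under eq_bigr do rewrite -mulr_sumr; rewrite -mulr_sumr mulrA.
congr (_ * _); first by ring.
rewrite [RHS]exchange_big; apply: eq_bigr => u /andP[_ /eqP mu].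
rewrite [RHS]exchange_big; apply: eq_bigr => v /andP[_ /eqP mv].
by apply: eq_bigr => w /andP[_ /eqP mw]; rewrite (LS' _ b).
Qed.

End Lift.

Lemma reduction_lift e e' a (S : stat e) (S' : stat e') (S1 : stat e.+1)
    (S1' : stat e'.+1) :
  lifts S S1 -> lifts S' S1' -> reduction a S S' -> reduction a S1 S1'.
Proof.
move=> LS LS' [Om [s [kappa [enc dom]]]].
exists {ffun 'I_3 -> Om}, (lift_sub s), (kappa ^+ 3).
by split; [exact: encoder_lift | exact: (dominated_lift enc LS LS' dom)].
Qed.

Lemma encoder_reindex e e' (Om Om' : finType)
    (s : Om -> 'I_(3 ^ e') -> 'I_(3 ^ e) + bool)
    (s' : Om' -> 'I_(3 ^ e') -> 'I_(3 ^ e) + bool) (f : Om -> Om') kappa :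
  bijective f -> (forall om, s om =1 s' (f om)) -> encoder s kappa ->
  encoder s' kappa.
Proof.
move=> bf /(_ _)/funext E [k0 em es]; split=> //.
  by case: (bf) => g fK gK om z; rewrite -{1}(gK om) -E em.
move=> b F; rewrite -es; apply: eq_bigr => z _.
by rewrite (reindex f) /=; [apply: eq_bigr => om _; rewrite E | exact: onW_bij].
Qed.

Lemma dominated_reindex e e' (Om Om' : finType)
    (s : Om -> 'I_(3 ^ e') -> 'I_(3 ^ e) + bool)
    (s' : Om' -> 'I_(3 ^ e') -> 'I_(3 ^ e) + bool) (f : Om -> Om') kappa a S S' :
  bijective f -> (forall om, s om =1 s' (f om)) -> dominated s kappa a S S' ->
  dominated s' kappa a S S'.
Proof.
move=> bf /(_ _)/funext E D t b; apply: le_trans (D t b).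
rewrite le_eqVlt; apply/orP; left; apply/eqP; apply: eq_bigr => z _.
by rewrite (reindex f) /=; [apply: eq_bigr => om _; rewrite E | exact: onW_bij].
Qed.

Definition error h : stat h := fun t x => (output t x != maj x)%:R.

(** Up to division by the number of hard inputs: the mean of [S t] is at least [c] times one minus
    twice the error probability of [t]. *)
Definition distributional_bound h (c : R) (S : stat h) : Prop :=
  forall t, c * \sum_(x | hard x) (1 - 2 * error t x) <= \sum_(x | hard x) S t x.

Lemma sum_hard h (F : inp h -> R) :
  \sum_(x | hard x) F x = \sum_b \sum_(x | hard_val b x) F x.
Proof.
rewrite (exchange_big_dep predT) //= big_mkcond; apply: eq_bigr => x _.
by rewrite big_mkcond big_bool /hard_val /=; case: (hard x) (maj x) => [] [];
  rewrite /= ?addr0 ?add0r.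
Qed.

(** The bound is applied to the encoded tree for each code and summed over the codes. As encoding
    preserves [maj], the errors of the encoded trees sum to [kappa] times those of [t], and [kappa]
    cancels. *)
Lemma distributional_bound_reduction e e' a c (S : stat e) (S' : stat e') :
  0 < a -> reduction a S S' -> distributional_bound c S ->
  distributional_bound (c / a) S'.
Proof.
move=> a0 [Om [s [kappa [enc dom]]]] B t; have k0 := encoder_gt0 enc.
have BS : c * \sum_b \sum_(z | hard_val b z) \sum_om
      (1 - 2 * error t (subst (s om) z))
    <= \sum_b \sum_(z | hard_val b z) \sum_om S (dtree_subst (s om) t) z.
  rewrite -!sum_hard exchange_big [leRHS]exchange_big mulr_sumr /=.
  apply: ler_sum => om _; apply: le_trans (B _).
  rewrite le_eqVlt; apply/orP; left; apply/eqP; congr (_ * _).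
  by apply: eq_bigr => z _; rewrite /error output_dtree_subst (maj_encoder enc).
have {}BS := le_trans BS (ler_sum _ (fun b _ => dom t b)).
move: BS; under eq_bigr do rewrite (sum_encoder enc _ (fun x => 1 - 2 * error t x)).
rewrite -!mulr_sumr -!sum_hard.
set E := \sum_(_ | _) _; set Q := \sum_(_ | _) _ => BS.
rewrite mulrAC ler_pdivrMr // -(ler_pM2r k0).
move: BS; rewrite mulrCA mulrC (mulrC a) -mulrA (mulrC Q) => /le_trans; apply.
by rewrite le_eqVlt; apply/orP; left; apply/eqP; ring.
Qed.

(** A tree may err more than half of the time; lowering the constant then raises the left side,
    which stays nonpositive, and [S] being nonnegative concludes. *)
Lemma distributional_bound_le h c c' (S : stat h) :
  (forall t x, 0 <= S t x) -> 0 <= c' <= c -> distributional_bound c S ->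
  distributional_bound c' S.
Proof.
move=> S0 /andP[c0 cc] B t.
have [E|E] := leP 0 (\sum_(x | hard x) (1 - 2 * error t x)).
  by apply: le_trans (B t); rewrite ler_wpM2r.
apply: (@le_trans _ _ 0); first by rewrite mulr_ge0_le0 // ltW.
by apply: sumr_ge0 => x _; apply: S0.
Qed.

End Encoders.

(** * Queries below the minority path *)

Section Statistics.
Variable R : realType.

Definition min_query h : stat R h := fun t x => (minority x \in queries t x)%:R.

Lemma min_query_ge0 h t x : 0 <= @min_query h t x.
Proof. exact: ler0n. Qed.

Lemma lifts_min_query h : lifts (@min_query h) (@min_query h.+1).
Proof.
move=> t b j w u v mw mu mv.
by rewrite /min_query mem_queries_block_sub (minority_arr _ mw mu mv).
Qed.

(* Leaf [q] lies below the node of depth [d] on the minority path of [x]. *)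
Fixpoint below (d h : nat) : inp h -> pred 'I_(3 ^ h) :=
  match d with
  | 0 => fun _ _ => true
  | d'.+1 =>
    match h return inp h -> pred 'I_(3 ^ h) with
    | 0 => fun _ _ => true
    | h'.+1 => fun x q =>
        let j := block (minority x) in
        (block q == j) && below d' (subinp x j) (inner q)
    end
  end.

Definition below_queries d h : stat R h :=
  fun t x => \sum_(q | below d x q) (q \in queries t x)%:R.

Lemma sum_leaves (V : nmodType) h (P : pred 'I_(3 ^ h.+1)) (F : 'I_(3 ^ h.+1) -> V) :
  \sum_(q | P q) F q = \sum_j \sum_(q | P (subleaf j q)) F (subleaf j q).
Proof.
rewrite pair_big_dep /= (reindex (fun p : 'I_3 * 'I_(3 ^ h) => subleaf p.1 p.2)) //=.
exists (fun q => (block q, inner q)) => [[j q] _|q _] /=.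
  by rewrite block_subleaf inner_subleaf.
by rewrite subleafK.
Qed.

Lemma below_arr d h b (j : 'I_3) (w u v : inp h) j' q :
  maj w = ~~ b -> maj u = b -> maj v = b ->
  below d.+1 (arr j w u v) (subleaf j' q) = (j' == j) && below d w q.
Proof.
move=> mw mu mv; rewrite /below -/below (minority_arr _ mw mu mv).
by rewrite !block_subleaf inner_subleaf; have [-> _ _] := subinp_arr j w u v.
Qed.

Lemma below_queries_arr d h b (j : 'I_3) (w u v : inp h) t :
  maj w = ~~ b -> maj u = b -> maj v = b ->
  below_queries d.+1 t (arr j w u v)
  = \sum_(q | below d w q) (subleaf j q \in queries t (arr j w u v))%:R.
Proof.
move=> mw mu mv; rewrite /below_queries sum_leaves (bigD1 j) // -[RHS]addr0.
congr (_ + _).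
  by apply: eq_bigl => q; rewrite (below_arr _ _ _ _ mw mu mv) eqxx.
apply: big1 => j' nj; rewrite big_pred0 // => q.
by rewrite (below_arr _ _ _ _ mw mu mv) (negbTE nj).
Qed.

Lemma lifts_below_queries d h :
  lifts (@below_queries d h) (@below_queries d.+1 h.+1).
Proof.
move=> t b j w u v mw mu mv; rewrite (below_queries_arr _ _ _ mw mu mv).
by apply: eq_bigr => q _; rewrite mem_queries_block_sub.
Qed.

Lemma below_full h (x : inp h) q : below h x q = (q == minority x).
Proof.
elim: h x q => [|h IH] x q.
  by rewrite /=; apply/esym/eqP/val_inj; case: q => -[].
rewrite /below -/below IH -[q in RHS]subleafK -[minority x in RHS]subleafK subleaf_eq.
by congr (_ && (_ == _)); rewrite [minority x]/= block_subleaf inner_subleaf.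
Qed.

Lemma below_queries_full h : @below_queries h h = @min_query h.
Proof.
apply: funext => t; apply: funext => x; rewrite /below_queries.
by rewrite (eq_bigl _ _ (below_full x)) big_pred1_eq.
Qed.

Lemma lifts_sub h (S1 S2 : stat R h) (S1' S2' : stat R h.+1) :
  lifts S1 S1' -> lifts S2 S2' ->
  lifts (fun t x => S1 t x - S2 t x) (fun t x => S1' t x - S2' t x).
Proof. by move=> L1 L2 t b j w u v mw mu mv; rewrite (L1 _ b) // (L2 _ b). Qed.

End Statistics.

(** * Insertion of a majority level *)

Section Insertion.
Variable h : nat.

(** The input becomes child [j] of a new root, next to hard siblings of values 0 and 1: the root
    keeps the value and the input is a majority child. The bit of the letter is the value of the
    sibling at [j + 1]. *)
Definition insertion :=
  (letter * {u : inp h | hard_val false u} * {v : inp h | hard_val true v})%type.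

Definition insert_sub (om : insertion) : 'I_(3 ^ h.+1) -> 'I_(3 ^ h) + bool :=
  let: ((c, j), u, v) := om in
  if c then block_sub j (val v) (val u) else block_sub j (val u) (val v).

Lemma sum_sig (V : nmodType) (T : finType) (P : pred T) (F : T -> V) :
  \sum_(u : {x | P x}) F (val u) = \sum_(x | P x) F x.
Proof.
rewrite (reindex_omap (val : {x | P x} -> T) insub) /=; last first.
  by move=> x Px; rewrite insubT.
by apply: eq_bigl => u; rewrite valK (valP u) eqxx.
Qed.

Lemma sum_insertion (V : nmodType) (G : 'I_3 -> inp h -> inp h -> V) :
  \sum_(om : insertion)
    (let: ((c, j), u, v) := om in
     if c then G j (val v) (val u) else G j (val u) (val v))
  = \sum_j \sum_c \sum_(u | hard_val c u) \sum_(v | hard_val (~~ c) v) G j u v.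
Proof.
pose F (c : bool) j (u : {u | hard_val false u}) (v : {v | hard_val true v}) : V :=
  if c then G j (val v) (val u) else G j (val u) (val v).
transitivity (\sum_c \sum_j \sum_u \sum_v F c j u v).
  rewrite pair_bigA /= pair_bigA /= pair_bigA /=.
  by apply: eq_bigr => -[[[c j] u] v].
rewrite /F exchange_big; apply: eq_bigr => j _; apply: eq_bigr => c _.
case: c.
  rewrite exchange_big (sum_sig (hard_val true)
    (fun v => \sum_(i : {u | hard_val false u}) G j v (val i))).
  by apply: eq_bigr => v _; rewrite (sum_sig (hard_val false) (G j v)).
rewrite (sum_sig (hard_val false)
  (fun v => \sum_(i : {u | hard_val true u}) G j v (val i))).
by apply: eq_bigr => v _; rewrite (sum_sig (hard_val true) (G j v)).
Qed.

Variable R : realType.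

Lemma sum_majority_child b (x : inp h.+1) (c : R) :
  hard_val b x -> \sum_(j | maj (subinp x j) == b) c = 2 * c.
Proof.
move=> Hx; apply: (addIr c).
transitivity (\sum_(j | maj (subinp x j) == b) c
              + \sum_(j | ~~ (maj (subinp x j) == b)) c).
  rewrite -[X in _ + X = _](sum_minority_child c Hx); congr (_ + _).
  by apply: eq_bigl => j; case: (maj _) b {Hx} => [] [].
transitivity (\sum_(j : 'I_3) c); last by rewrite sumr_const card_ord; ring.
by rewrite [RHS](bigID (fun j => maj (subinp x j) == b)).
Qed.

Lemma maj_insert om z : maj (subst (insert_sub om) z) = maj z.
Proof.
case: om => [[[c j] u] v].
have /andP[_ /eqP mu] := valP u; have /andP[_ /eqP mv] := valP v.
by case: c; rewrite /insert_sub subst_block_sub maj_arr mu mv /maj3; case: (maj z).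
Qed.

(** An input together with an insertion is the same as a taller hard input with a marked majority
    child; [G] may depend on the mark. *)
Lemma sum_insert (V : nmodType) b (G : 'I_3 -> inp h.+1 -> V) :
  \sum_(z | hard_val b z) \sum_(om : insertion) G om.1.1.2 (subst (insert_sub om) z)
  = \sum_(x | hard_val b x) \sum_(j | maj (subinp x j) == b) G j x.
Proof.
rewrite sum_hard_majority [RHS]exchange_big /=; apply: eq_bigr => z _.
rewrite -(sum_insertion (fun j u v => G j (arr j z u v))).
by apply: eq_bigr => -[[[[] j] u] v] _; rewrite subst_block_sub.
Qed.

(** Here [kappa] is 2 because a hard input has two majority children to mark. *)
Lemma encoder_insert : encoder insert_sub (2 : R).
Proof.
split; [by [] | exact: maj_insert |].
move=> b F; rewrite (sum_insert b (fun _ => F)) mulr_sumr.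
by apply: eq_bigr => x Hx; rewrite (sum_majority_child _ Hx).
Qed.

(** The encoded tree queries exactly the leaves that [t] queries under the marked child, and the two
    majority children together contain the leaves outside the minority child. *)
Lemma sum_below_insert b t :
  \sum_(z | hard_val b z) \sum_om
     below_queries R 0 (dtree_subst (insert_sub om) t) z
  = \sum_(x | hard_val b x) (below_queries R 0 t x - below_queries R 1 t x).
Proof.
pose G j (x : inp h.+1) : R := \sum_q (subleaf j q \in queries t x)%:R.
transitivity (\sum_(x | hard_val b x) \sum_(j | maj (subinp x j) == b) G j x).
  rewrite -sum_insert; apply: eq_bigr => z _.
  apply: eq_bigr => -[[[c j] u] v] _; rewrite /below_queries /G /=.
  by apply: eq_bigr => q _; case: c; rewrite mem_queries_block_sub subst_block_sub.
rewrite !sum_hard_val; apply: eq_bigr => j _.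
apply: eq_bigr => w /andP[_ /eqP mw]; apply: eq_bigr => u /andP[_ /eqP mu].
apply: eq_bigr => v /andP[_ /eqP mv]; rewrite (below_queries_arr _ _ _ _ mw mu mv) /=.
rewrite /below_queries sum_leaves [X in _ = X - _](bigD1 j) //= addrAC subrr add0r.
apply: eq_bigl => j'; have [e0 e1 e2] := subinp_arr j w u v.
have [->|->|->] := ord3_cases j j'; rewrite ?e0 ?e1 ?e2 ?mw ?mu ?mv ?eqxx.
- by case: (b).
- by case: j {e0 e1 e2} => -[|[|[|]]].
- by case: j {e0 e1 e2} => -[|[|[|]]].
Qed.

End Insertion.

(** For [d = 0] the ratio 1/2 cancels [kappa = 2] and equality holds. Lifting [d] times moves the
    inserted level from the root to depth [d]. *)
Lemma reduction_insert (R : realType) d h : (d <= h)%N ->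
  reduction (2^-1 : R) (@below_queries R d h)
    (fun t x => below_queries R d t x - below_queries R d.+1 t (x : inp h.+1)).
Proof.
elim: d h => [|d IH] h; last first.
  case: h => // h /IH; apply: reduction_lift; first exact: lifts_below_queries.
  by apply: lifts_sub; apply: lifts_below_queries.
move=> _; exists (insertion h), (@insert_sub h), 2; split; first exact: encoder_insert.
by move=> t b; rewrite mulVf ?mul1r ?sum_below_insert.
Qed.

(** * The encoding psi and the bound 2^k *)

Lemma sum_ord3_from (V : nmodType) (j : 'I_3) (F : 'I_3 -> V) :
  \sum_i F i = F j + (F (j + 1) + F (j + 2)).
Proof. by rewrite (reindex_inj (addrI j)) sum_ord3 !add0r addr0. Qed.

(** While both runs follow the same path, the queried variable is neither [p] nor [q], so the
    answers agree. *)
Lemma eq_queries n (t : dtree n) (x y : input n) p q :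
  (forall i, i != p -> i != q -> x i = y i) ->
  p \notin queries t x -> q \notin queries t y -> queries t x = queries t y.
Proof.
move=> xy; elim: t => [//|i t0 IH0 t1 IH1] /=; rewrite !inE !negb_or.
move=> /andP[ip Hx] /andP[iq Hy]; rewrite eq_sym in ip; rewrite eq_sym in iq.
congr (_ :: _); move: Hx Hy; rewrite (xy i) //.
by case: (y i); [exact: IH1 | exact: IH0].
Qed.

(** * Trees on three bits *)

Section HeightOne.
Variable R : realType.

Definition const_inp (b : bool) : inp 0 := [ffun=> b].

Lemma inp0_eq (w : inp 0) : w = const_inp (maj w).
Proof.
apply/ffunP => i; rewrite ffunE /=; congr (w _).
by apply: val_inj; case: i => -[].
Qed.

Lemma hard_val0 b (w : inp 0) : hard_val b w = (w == const_inp b).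
Proof.
rewrite /hard_val /=; apply/eqP/eqP => [<-|->]; last by rewrite ffunE.
exact: inp0_eq.
Qed.

(* The inequality for trees of height 1, with [q j i] telling whether position [i]
   is queried on the input whose minority position is [j]: it is tight for the
   tree that queries the other two positions iff its first answer is the minority
   value. *)
Lemma sum_min_query1 b (t : dtree (3 ^ 1)) :
  \sum_(x | hard_val b x) (below_queries R 0 t x - min_query R t (x : inp 1))
  <= 4 * \sum_(x | hard_val b x) min_query R t x.
Proof.
pose z j := arr j (const_inp (~~ b)) (const_inp b) (const_inp b).
pose q j i : bool := subleaf i (leaf0 0) \in queries t (z j).
have E (F : inp 1 -> R) : \sum_(x | hard_val b x) F x = \sum_j F (z j).
  rewrite sum_hard_val; apply: eq_bigr => j _.
  do 3 (rewrite (eq_bigl _ _ (hard_val0 _)) big_pred1_eq).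
  by [].
have mc c : maj (const_inp c) = c by rewrite /= ffunE.
have minq j : min_query R t (z j) = (q j j)%:R.
  by rewrite /min_query /z (@minority_arr _ b) ?mc.
have belq j : below_queries R 0 t (z j) = \sum_i (q j i)%:R.
  rewrite /below_queries sum_leaves; apply: eq_bigr => i _.
  by rewrite (big_pred1 (leaf0 0)) // => p; apply/esym/eqP/val_inj; case: p => -[].
rewrite !E; under eq_bigr do rewrite minq belq.
under [X in _ <= _ * X]eq_bigr do rewrite minq.
case Et: t => [c|i0 t0 t1].
  by rewrite /q Et /= !big1 ?mulr0 // => j _; rewrite ?big1 ?subrr.
pose j := block i0.
have qj i : q i j.
  rewrite /q Et /= inE; apply/orP; left; apply/eqP.
  by rewrite -[RHS]subleafK; congr subleaf; apply: val_inj; case: (inner _) => -[].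
have neq12 : j + 1 != j + 2 by case: (j) => -[|[|[|]]].
(* The inputs [z (j + 1)] and [z (j + 2)] differ only at these two positions, so a tree that misses
   the minority on both makes the same queries on both. *)
have q12 : ~~ q (j + 1) (j + 1) -> ~~ q (j + 2) (j + 2) ->
    ~~ q (j + 1) (j + 2) && ~~ q (j + 2) (j + 1).
  move=> q1 q2; suff Eq : queries t (z (j + 1)) = queries t (z (j + 2)).
    by move: q1 q2; rewrite /q Eq => -> ->.
  move: q1 q2; rewrite /q; apply: eq_queries => i.
  rewrite -[i]subleafK; have -> : inner i = leaf0 0.
    by apply: val_inj; case: (inner _) => -[].
  rewrite !subleaf_eq !eqxx !andbT => n1 n2.
  rewrite /z !ffunE block_subleaf inner_subleaf (negbTE n1) (negbTE n2).
  by case: ifP; case: ifP; rewrite !ffunE.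
(* The left side is at most 6. If the minority is queried on [z (j + 1)] or [z (j + 2)], the right
   side is at least 8; otherwise it is 4, and [q12] brings the left side down to 4. *)
rewrite !(sum_ord3_from j) !qj.
move: q12; case: (q j (j + 1)); case: (q j (j + 2)); case: (q (j + 1) (j + 1));
case: (q (j + 1) (j + 2)); case: (q (j + 2) (j + 1)); case: (q (j + 2) (j + 2));
  move=> q12; (try by have := q12 isT isT); rewrite /=; lra.
Qed.

End HeightOne.

(** The entries of a code word other than the encoded bit depend only on the letter, so they are
    read off the word of [false]. *)
Definition psi1_sub d (r : {ffun 'I_(3 ^ d) -> letter}) (i : 'I_(3 ^ d.+1)) :
    'I_(3 ^ d) + bool :=
  if child_pos i == (r (parent i)).2 then inl (parent i)
  else inr (tnth (encode_bit false (r (parent i))) (child_pos i)).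

Lemma psi1E d (y : inp d) r : psi1 y r = subst (psi1_sub r) y.
Proof.
apply/ffunP => i; rewrite !ffunE /psi1_sub.
case: (r (parent i)) => b j; move: (child_pos i) => c /=.
by case: j => -[|[|[|]]] //= ?; case: c => -[|[|[|]]].
Qed.

Lemma psi1_sub_ex d (r : {ffun 'I_(3 ^ d) -> letter}) q :
  exists i, psi1_sub r i = inl q.
Proof.
have lt : (q * 3 + (r q).2 < 3 ^ d.+1)%N.
  rewrite expnSr (@leq_trans (q * 3 + 3)%N) ?ltn_add2l//.
  by rewrite -mulSnr leq_mul2r ltn_ord orbT.
exists (Ordinal lt); rewrite /psi1_sub.
have -> : parent (Ordinal lt) = q.
  by apply: val_inj; rewrite /= divnMDl // divn_small ?addn0.
suff -> : child_pos (Ordinal lt) = (r q).2 by rewrite eqxx.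
by apply: val_inj; rewrite /= modnMDl modn_small.
Qed.

Lemma psi1_sub_inj d (r : {ffun 'I_(3 ^ d) -> letter}) q i i' :
  psi1_sub r i = inl q -> psi1_sub r i' = inl q -> i = i'.
Proof.
rewrite /psi1_sub; case: eqP => // ec [ep]; case: eqP => // ec' [ep'].
have Ep : parent i = parent i' by rewrite ep ep'.
have Ec : child_pos i = child_pos i' by rewrite ec ec' Ep.
apply: val_inj; rewrite /= (divn_eq i 3) (divn_eq i' 3).
by congr (_ * _ + _)%N; [exact: (congr1 val Ep) | exact: (congr1 val Ec)].
Qed.

Lemma parent_subleaf d j (i : 'I_(3 ^ d.+1)) :
  parent (subleaf j i) = subleaf j (parent i).
Proof.
by apply: val_inj; rewrite /= {1}expnSr mulnA divnMDl.
Qed.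

Lemma child_pos_subleaf d j (i : 'I_(3 ^ d.+1)) :
  child_pos (subleaf j i) = child_pos i.
Proof. by apply: val_inj; rewrite /= {1}expnSr mulnA modnMDl. Qed.

(** Encoding every leaf proceeds subtree by subtree, so the one-level encoding of height [d.+1] is
    the lift of that of height [d]. *)
Lemma lift_psi1_sub d (g : {ffun 'I_3 -> {ffun 'I_(3 ^ d) -> letter}}) :
  lift_sub (@psi1_sub d) g =1 psi1_sub (join g).
Proof.
move=> i; rewrite -(subleafK i) /lift_sub block_subleaf inner_subleaf.
rewrite /psi1_sub parent_subleaf child_pos_subleaf ffunE block_subleaf inner_subleaf.
by case: eqP.
Qed.

(** At height 0 the siblings are constants, and the cyclic order of [arr] is that of [encode_bit]:
    encoding a bit is inserting a level above it. *)
Lemma insert_psi1_sub (om : insertion 0) :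
  insert_sub om =1 psi1_sub [ffun=> om.1.1].
Proof.
case: om => [[[c j] u] v] i.
have eb : block i = child_pos i.
  by apply: val_inj; rewrite /= expn0 divn1 modn_small.
have ei : inner i = parent i.
  by apply: val_inj; rewrite /= expn0 modn1 divn_small.
have val_hard b (w : {w : inp 0 | hard_val b w}) : val w = const_inp b.
  by apply/eqP; rewrite -hard_val0 (valP w).
case: c; rewrite /insert_sub /psi1_sub /block_sub !ffunE /= eb ei !val_hard;
case: ifP => // ne; congr inr; rewrite ?ne ?ffunE; move: ne;
move: (child_pos i) => p;
by case: j => -[|[|[|]]] //= ?; case: p => -[|[|[|]]] // ?; rewrite /= ffunE.
Qed.

Section PsiEncoder.
Variable R : realType.

Lemma insertion0_bij :
  bijective (fun om : insertion 0 => [ffun _ : 'I_(3 ^ 0) => om.1.1]).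
Proof.
have hv b : hard_val b (const_inp b) by rewrite hard_val0.
exists (fun r : {ffun 'I_(3 ^ 0) -> letter} =>
  (r (leaf0 0), Sub (const_inp false) (hv false), Sub (const_inp true) (hv true))
    : insertion 0) => [[[l u] v]|r].
  rewrite ffunE /=; congr (_, _, _); apply: val_inj => /=; apply/esym/eqP;
  rewrite -hard_val0; [exact: (valP u) | exact: (valP v)].
apply/ffunP => i; rewrite ffunE /=; congr (r _).
by apply: val_inj; case: i => -[].
Qed.

Lemma encoder_psi1 d : exists kappa : R, encoder (@psi1_sub d) kappa /\
  dominated (@psi1_sub d) kappa 2 (@min_query R d) (@min_query R d.+1).
Proof.
elim: d => [|d [kappa [enc dom]]].
  exists 2; split.
    exact: (encoder_reindex insertion0_bij insert_psi1_sub (encoder_insert 0 R)).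
  apply: (dominated_reindex insertion0_bij insert_psi1_sub) => t b.
  (* The constant 4 of [sum_min_query1] is the ratio 2 times [kappa = 2]. *)
  rewrite -[@min_query R 0]below_queries_full sum_below_insert.
  have := @sum_min_query1 R b t; rewrite -[@min_query R 1]below_queries_full.
  by rewrite (_ : 2 * 2 = 4 :> R) // -natrM.
exists (kappa ^+ 3); split.
  exact: (encoder_reindex (join_bij _ _) (@lift_psi1_sub d) (encoder_lift enc)).
apply: (dominated_reindex (join_bij _ _) (@lift_psi1_sub d)).
by apply: (dominated_lift enc _ _ dom); apply: lifts_min_query.
Qed.

Lemma dtree_subst_id n (t : dtree n) : dtree_subst (fun i => inl i) t = t.
Proof. by elim: t => //= i t0 -> t1 ->. Qed.

(** One-level encodings are composed: the ratios and the [kappa] multiply. The last two clauses say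
    that each bit is copied to exactly one position, which identifies [encoded_pos]. *)
Lemma encoder_psi k d h (e : (k + d)%N = h) :
  exists (s : enc_rand k d -> 'I_(3 ^ h) -> 'I_(3 ^ d) + bool) (kappa : R),
    [/\ forall y r, psi e y r = subst (s r) y,
        encoder s kappa,
        dominated s kappa (2 ^+ k) (@min_query R d) (@min_query R h),
        forall r q, exists i, s r i = inl q
      & forall r q i i', s r i = inl q -> s r i' = inl q -> i = i'].
Proof.
elim: k d h e => [|k IH] d h e.
  case: h / e; exists (fun _ i => inl i), 1.
  have sub_id (y : inp d) : subst (fun i => inl i) y = y.
    by apply/ffunP => i; rewrite ffunE.
  have sum1 (F : unit -> R) : \sum_(u : enc_rand 0 d) F u = F tt.
    by rewrite (big_pred1 tt) // => -[].
  split => [y r| |t b|r q|r q i i' [->] [->]] //.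
  - split=> // [_ z|b F]; first by rewrite sub_id.
    rewrite mul1r; apply: eq_bigr => z _.
    by rewrite sum1 sub_id.
  - rewrite expr0 !mul1r; apply: ler_sum => z _; rewrite sum1.
    by rewrite dtree_subst_id.
  - by exists q.
have [s [kappa [Es enc dom ex inj]]] := IH d.+1 h (etrans (addnS k d) e).
have [kappa1 [enc1 dom1]] := encoder_psi1 d.
exists (fun Rr => subst_comp (psi1_sub Rr.2) (s Rr.1)), (kappa1 * kappa); split.
- by move=> y r; rewrite -subst_subst -psi1E -Es.
- split; first by rewrite mulr_gt0 ?(encoder_gt0 enc) ?(encoder_gt0 enc1).
    by move=> r z; rewrite -subst_subst (maj_encoder enc) (maj_encoder enc1).
  move=> b F.
  transitivity (\sum_(z | hard_val b z) \sum_r \sum_r'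
      F (subst (s r') (subst (psi1_sub r) z))).
    apply: eq_bigr => z _; rewrite exchange_big pair_bigA.
    by apply: eq_bigr => r _; rewrite subst_subst.
  rewrite (sum_encoder enc1 b (fun x => \sum_r' F (subst (s r') x))).
  by rewrite (sum_encoder enc) mulrA.
- move=> t b; apply: (@le_trans _ _ (\sum_r' 2 * kappa1 *
      \sum_(x | hard_val b x) min_query R (dtree_subst (s r') t) x)).
    rewrite [leLHS](_ : _ = \sum_r' \sum_(z | hard_val b z) \sum_r
      min_query R (dtree_subst (psi1_sub r) (dtree_subst (s r') t)) z).
      by apply: ler_sum => r' _; apply: dom1.
    rewrite [RHS]exchange_big; apply: eq_bigr => z _; rewrite pair_bigA.
    by apply: eq_bigr => r _; rewrite dtree_subst_comp.
  rewrite -mulr_sumr exchange_big /=.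
  rewrite (_ : 2 ^+ k.+1 * (kappa1 * kappa) * _ = 2 * kappa1 * (2 ^+ k * kappa *
    \sum_(x | hard_val b x) min_query R t x)); last by rewrite exprS; ring.
  by rewrite ler_pM2l ?mulr_gt0 ?(encoder_gt0 enc1).
- move=> r q; have [p Ep] := psi1_sub_ex r.2 q; have [i Ei] := ex r.1 p.
  by exists i; rewrite /subst_comp Ei.
- move=> r q i i'; rewrite /subst_comp.
  case Ei: (s r.1 i) => [p|//]; case Ei': (s r.1 i') => [p'|//] Ep Ep'.
  by apply: (inj r.1 p) => //; rewrite Ei' (psi1_sub_inj Ep Ep').
Qed.

End PsiEncoder.

(** * The ratio alpha *)

Definition neg_inp n (x : input n) : input n := [ffun i => ~~ x i].

Lemma neg_inpK n : involutive (@neg_inp n).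
Proof. by move=> x; apply/ffunP => i; rewrite !ffunE negbK. Qed.

(** Only the queries are meant to be those on the negated input; the outputs are left as they
    are. *)
Fixpoint flip n (t : dtree n) : dtree n :=
  match t with
  | Output b => Output n b
  | Query i t0 t1 => Query i (flip t1) (flip t0)
  end.

Lemma queries_flip n (t : dtree n) (x : input n) :
  queries (flip t) x = queries t (neg_inp x).
Proof.
elim: t => //= i t0 IH0 t1 IH1; rewrite ffunE.
by case: (x i); rewrite ?IH0 ?IH1.
Qed.

Lemma subinp_neg h (x : inp h.+1) j : subinp (neg_inp x) j = neg_inp (subinp x j).
Proof. by apply/ffunP => i; rewrite !ffunE. Qed.

Lemma maj_neg h (x : inp h) : maj (neg_inp x) = ~~ maj x.
Proof.
elim: h x => [|h IH] x; first by rewrite /= ffunE.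
rewrite /= !subinp_neg !IH /maj3.
by case: (maj _); case: (maj _); case: (maj _).
Qed.

Lemma hard_neg h (x : inp h) : hard (neg_inp x) = hard x.
Proof.
elim: h x => [//|h IH] x /=; congr (_ && ~~ _).
  by apply: eq_forallb => j; rewrite subinp_neg IH.
apply: eq_forallb => j; apply: eq_forallb => j'.
by rewrite !subinp_neg !maj_neg (inj_eq negb_inj).
Qed.

Lemma hard_val_neg h b (x : inp h) : hard_val b (neg_inp x) = hard_val (~~ b) x.
Proof. by rewrite /hard_val hard_neg maj_neg; case: b (maj x) => [] []. Qed.

Lemma minority_neg h (x : inp h) : minority (neg_inp x) = minority x.
Proof.
elim: h x => [//|h IH] x.
pose o (x : inp h.+1) := odflt child0 [pick j | maj (subinp x j) != maj x].
have E z : minority z = subleaf (o z) (minority (subinp z (o z))) by [].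
have Eo : o (neg_inp x) = o x.
  congr odflt; apply: eq_pick => j.
  by rewrite subinp_neg !maj_neg (inj_eq negb_inj).
by rewrite !E Eo subinp_neg IH.
Qed.

Definition flip_letter (l : letter) : letter := (~~ l.1, l.2).

Lemma psi1_neg d (y : inp d) (r : {ffun 'I_(3 ^ d) -> letter}) :
  psi1 (neg_inp y) [ffun i => flip_letter (r i)] = neg_inp (psi1 y r).
Proof.
apply/ffunP => i; rewrite !ffunE; case: (r _) => b j; move: (child_pos i) => c.
by case: j => -[|[|[|]]] //= ?; case: c => -[|[|[|]]].
Qed.

Fixpoint flip_rand k d : enc_rand k d -> enc_rand k d :=
  match k with
  | 0 => id
  | k'.+1 => fun Rr => (flip_rand Rr.1, [ffun i => flip_letter (Rr.2 i)])
  end.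

Lemma flip_randK k d : involutive (@flip_rand k d).
Proof.
elim: k d => [//|k IH] d [r l] /=; rewrite IH; congr (_, _).
by apply/ffunP => i; rewrite !ffunE /flip_letter /= negbK; case: (l i).
Qed.

Lemma psi_neg k d h (e : (k + d)%N = h) y r :
  psi e (neg_inp y) (flip_rand r) = neg_inp (psi e y r).
Proof.
elim: k d h e y r => [|k IH] d h e y r; first by case: h / e.
by rewrite /= psi1_neg IH.
Qed.

Lemma encode_neg k y (r : enc_rand k 0) :
  encode (~~ y) (flip_rand r) = neg_inp (encode y r).
Proof.
rewrite /encode -psi_neg; congr psi.
by apply/ffunP => i; rewrite !ffunE.
Qed.

Lemma encoded_pos_flip k (r : enc_rand k 0) :
  encoded_pos (flip_rand r) = encoded_pos r.
Proof.
congr odflt; apply: eq_pick => q; apply/forallP/forallP => H y.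
  by have := H (~~ y); rewrite encode_neg ffunE (inj_eq negb_inj).
by rewrite -[y]negbK encode_neg ffunE (inj_eq negb_inj); apply: H.
Qed.

Fixpoint enc_rand0 k d : enc_rand k d :=
  match k with
  | 0 => tt
  | k'.+1 => (enc_rand0 k' d.+1, [ffun=> (false, ord0)])
  end.

Section Alpha.
Variables (R : realType) (k : nat).

(** [sum_encoder] applied to the indicator of the other inputs gives a vanishing sum of nonnegative
    terms. *)
Lemma hard_encoder e e' (Om : finType) (s : Om -> 'I_(3 ^ e') -> 'I_(3 ^ e) + bool)
    (kappa : R) b om z :
  encoder s kappa -> hard_val b z -> hard_val b (subst (s om) z).
Proof.
move=> enc Hz; have := sum_encoder enc b (fun x => (~~ hard_val b x)%:R).
rewrite [in RHS]big1 ?mulr0 => [|x ->//] /eqP.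
rewrite psumr_eq0 => [/allP/(_ z)|x _]; last by apply: sumr_ge0 => i _; apply: ler0n.
rewrite mem_index_enum Hz /= => /(_ isT).
rewrite psumr_eq0 => [/allP/(_ om)|x _]; last exact: ler0n.
by rewrite mem_index_enum /= => /(_ isT); rewrite pnatr_eq0; case: hard_val.
Qed.

(** With [minority_query], the numerator and denominator of [alpha_of] up to normalization, for
    either value [b]. *)
Definition encoded_query (C : dtree (3 ^ k)) (b : bool) : R :=
  \sum_(r : enc_rand k 0) (encoded_pos r \in queries C (encode b r))%:R.

Definition minority_query (C : dtree (3 ^ k)) (b : bool) : R :=
  \sum_(x | hard_val b x) min_query R C x.

Lemma encoded_query_flip C b : encoded_query (flip C) b = encoded_query C (~~ b).
Proof.
rewrite /encoded_query [RHS](reindex_inj (inv_inj (@flip_randK k 0))).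
by apply: eq_bigr => r _; rewrite encoded_pos_flip encode_neg queries_flip.
Qed.

Lemma minority_query_flip C b : minority_query (flip C) b = minority_query C (~~ b).
Proof.
rewrite /minority_query [RHS](reindex_inj (inv_inj (@neg_inpK _))) /=.
apply: eq_big => [x|x _]; first by rewrite hard_val_neg negbK.
by rewrite /min_query queries_flip minority_neg.
Qed.

Lemma encode_encoder : exists (s : enc_rand k 0 -> 'I_(3 ^ k) -> 'I_(3 ^ 0) + bool)
    (kappa : R),
  [/\ encoder s kappa,
      forall b r, @encode k b r = subst (s r) (const_inp b),
      forall C b, \sum_(z | hard_val b z) \sum_r min_query R (dtree_subst (s r) C) z
                  = encoded_query C b
    & forall C b, encoded_query C b <= 2 ^+ k * kappa * minority_query C b].
Proof.
have [s [kappa [Es enc dom ex inj]]] := encoder_psi R (addn0 k).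
(* A position holding a constant [b] cannot equal the encoded bit when that bit is [~~ b]. The
   default of [encoded_pos] is excluded since some position carries the bit. *)
have pos r : s r (encoded_pos r) = inl (leaf0 0).
  rewrite /encoded_pos; case: pickP => [q /forallP H|H] /=.
    case Eq: (s r q) => [p|b]; first by congr inl; apply: val_inj; case: p {Eq} => -[].
    by have := H (~~ b); rewrite /encode Es ffunE Eq; case: (b).
  have [q Eq] := ex r (leaf0 0); have /forallP[] := negbT (H q).
  by move=> y; rewrite /encode Es !ffunE Eq ffunE.
have sumE C b : \sum_(z | hard_val b z) \sum_r min_query R (dtree_subst (s r) C) z
                  = encoded_query C b.
  rewrite (eq_bigl _ _ (hard_val0 b)) big_pred1_eq; apply: eq_bigr => r _.
  rewrite /min_query mem_queries_dtree_subst /encode Es -has_pred1.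
  congr (nat_of_bool _)%:R; apply: eq_has => i /=.
  apply/eqP/eqP => [Ei|->]; last exact: pos.
  exact: (inj r (leaf0 0)).
exists s, kappa; split => // [b r|C b]; first by rewrite /encode Es.
by rewrite -sumE; apply: dom.
Qed.

Lemma in_hard_inputs0 h : hard_inputs0 h =i hard_val false.
Proof. by move=> x; rewrite !inE. Qed.

(** Each hard input of value 0 has exactly [kappa] encodings, all of them encoding the bit 0, so the
    two nested means become one sum over [r]. *)
Lemma alpha_ofE s kappa (C : dtree (3 ^ k)) :
  encoder s kappa ->
  (forall b r, @encode k b r = subst (s r) (const_inp b)) ->
  alpha_of R C = encoded_query C false / kappa / minority_query C false.
Proof.
move=> enc Es; pose n := #|hard_inputs0 k|%:R : R.

have card_enc (x : inp k) : hard_val false x -> #|encodings x|%:R = kappa :> R.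
  move=> Hx; have := sum_encoder enc false (fun x' => (x' == x)%:R).
  rewrite [in RHS](bigD1 x) //= eqxx [X in _ * (_ + X)]big1 ?addr0 ?mulr1; last first.
    by move=> x' /andP[_ /negbTE ->].
  move=> <-.
  rewrite (eq_bigl _ _ (hard_val0 false)) big_pred1_eq.
  transitivity (\sum_y \sum_(r : enc_rand k 0) ((y, r) \in encodings x)%:R : R).
    rewrite pair_bigA -sum1_card natr_sum big_mkcond /=.
    by apply: eq_bigr => -[y r] _; case: ifP.
  rewrite big_bool /= big1 ?add0r => [|r _].
    by apply: eq_bigr => r _; rewrite inE /= Es; case: eqP.
  rewrite inE /=; case: eqP => // Er; move: Hx => /andP[_].
  by rewrite -Er Es (maj_encoder enc) /= ffunE.
rewrite /alpha_of [X in _ / X](_ : _ = minority_query C false / n); last first.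
  by rewrite /unif_mean; congr (_ / _); apply: eq_bigl => x; rewrite in_hard_inputs0.
rewrite [X in X / _](_ : _ = encoded_query C false / kappa / n).
  have [n0|n0] := eqVneq n 0; last by rewrite invf_div mulrA divfK.
  rewrite n0 invr0 !mulr0 invr0 mulr0 /minority_query big1 ?invr0 ?mulr0 // => x.
  move=> Hx; have : x \in hard_inputs0 k by rewrite in_hard_inputs0.
  by move/eqP: n0; rewrite /n pnatr_eq0 cards_eq0 => /eqP ->; rewrite inE.
congr (_ / _); rewrite /encoded_query mulr_suml.
rewrite (eq_bigl _ _ (@in_hard_inputs0 k)).
transitivity (\sum_(x | hard_val false x) \sum_(yr in encodings x)
   (encoded_pos yr.2 \in queries C (encode yr.1 yr.2))%:R / kappa : R).
  apply: eq_bigr => x Hx; rewrite /unif_mean card_enc // mulr_suml.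
  by apply: eq_bigr => yr; rewrite inE => /eqP ->.
rewrite (exchange_big_dep predT) //=.
transitivity (\sum_y \sum_(r : enc_rand k 0)
    \sum_(x | hard_val false x && ((y, r) \in encodings x))
      (encoded_pos r \in queries C (encode y r))%:R / kappa : R).
  by rewrite pair_bigA; apply: eq_bigr => -[y r].
rewrite big_bool /= big1 ?add0r => [|r _].
  apply: eq_bigr => r _; rewrite (big_pred1 (encode false r)) // => x.
  rewrite inE /= eq_sym; case: eqP => [->|]; last by rewrite andbF.
  by rewrite Es (hard_encoder _ enc) ?hard_val0 ?eqxx.
rewrite big_pred0 // => x; rewrite inE /=; case: eqP => [<-|]; last by rewrite andbF.
by rewrite Es /hard_val (maj_encoder enc) /= ffunE !andbF.
Qed.

Lemma alpha_of_le (C : dtree (3 ^ k)) : alpha_of R C <= 2 ^+ k.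
Proof.
have [s [kappa [enc Es _ dom]]] := encode_encoder.
rewrite (alpha_ofE _ enc Es).
have := dom C false; have : 0 <= minority_query C false by apply: sumr_ge0.
rewrite le_eqVlt => /orP[/eqP <- _|N0]; first by rewrite invr0 mulr0 exprn_ge0.
by rewrite !ler_pdivrMr ?(encoder_gt0 enc) // mulrAC.
Qed.

Lemma alpha_le : alpha R k <= 2 ^+ k.
Proof.
apply: ge_sup => [|_ [C _ <-]]; last exact: alpha_of_le.
exists (alpha_of R (Query (leaf0 k) (Output _ true) (Output _ true))).
by exists (Query (leaf0 k) (Output _ true) (Output _ true)).
Qed.

Lemma alpha_of_le_alpha (C : dtree (3 ^ k)) :
  makes_query C -> alpha_of R C <= alpha R k.
Proof.
move=> qC; apply: ub_le_sup; last by exists C.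
by exists (2 ^+ k) => _ [C' _ <-]; apply: alpha_of_le.
Qed.

(** The witness queries the encoded position of one fixed [r]. Its numerator is positive, hence so
    is its denominator by the bound [2 ^+ k]. *)
Lemma alpha_gt0 : 0 < alpha R k.
Proof.
have [s [kappa [enc Es _ dom]]] := encode_encoder.
pose r := enc_rand0 k 0.
pose C := Query (encoded_pos r) (Output _ true) (Output _ true).
apply: lt_le_trans (alpha_of_le_alpha (_ : makes_query C)) => //.
have A0 : 0 < encoded_query C false.
  rewrite /encoded_query (bigD1 r) //= inE eqxx ltr_pwDl //.
  by apply: sumr_ge0 => i _; apply: ler0n.
have N0 : 0 < minority_query C false.
  have := lt_le_trans A0 (dom C false).
  by rewrite pmulr_rgt0 // mulr_gt0 ?exprn_gt0 ?(encoder_gt0 enc).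
by rewrite (alpha_ofE _ enc Es) !divr_gt0 ?(encoder_gt0 enc).
Qed.

Lemma reduction_alpha0 : reduction (alpha R k) (@min_query R 0) (@min_query R k).
Proof.
have [s [kappa [enc Es sumE dom]]] := encode_encoder; have k0 := encoder_gt0 enc.
exists (enc_rand k 0), s, kappa; split => // t b; rewrite sumE.
suff H C : encoded_query C false <= alpha R k * kappa * minority_query C false.
  by case: b => //; have := H (flip t); rewrite encoded_query_flip minority_query_flip.
(* If the minority is never queried, [alpha_of] is 0 by convention and gives no information; the
   bound [2 ^+ k] shows that the numerator vanishes too. *)
have := dom C false; have : 0 <= minority_query C false by apply: sumr_ge0.
rewrite le_eqVlt => /orP[/eqP <-|N0]; rewrite ?mulr0 // => _.
case: C N0 => [c|i t0 t1] N0.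
  rewrite /encoded_query big1 ?mulr_ge0 ?(ltW alpha_gt0) ?(ltW k0) //.
  exact: ltW.
have := alpha_of_le_alpha (isT : makes_query (Query i t0 t1)).
by rewrite (alpha_ofE _ enc Es) !ler_pdivrMr // mulrAC.
Qed.

Lemma reduction_alpha d :
  reduction (alpha R k) (@min_query R d) (@min_query R (d + k)).
Proof.
elim: d => [|d IH]; first exact: reduction_alpha0.
by apply: reduction_lift IH; apply: lifts_min_query.
Qed.

End Alpha.

(** * Lower bounds *)

Section Bounds.
Variable R : realType.

Lemma distributional_bound0 : distributional_bound 1 (@min_query R 0).
Proof.
move=> t; rewrite !sum_hard !big_bool /=.
do 4 (rewrite (eq_bigl _ _ (hard_val0 _)) big_pred1_eq).
rewrite /error /min_query /=; case: t => [c|i t0 t1] /=.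
  by rewrite !ffunE; case: c => /=; lra.
have -> : i = leaf0 0 by apply: val_inj; case: i => -[].
rewrite !inE eqxx /=.
have E (b : bool) : 0 <= b%:R :> R by apply: ler0n.
by move: (E (output t0 (const_inp true) != const_inp true (leaf0 0)));
   rewrite !ffunE /=; have := E (output t1 (const_inp true) != true);
   have := E (output t0 (const_inp false) != false); lra.
Qed.

Lemma distributional_bound_half r : distributional_bound (2 ^- r) (@min_query R r).
Proof.
elim: r => [|r IH]; first by rewrite invr1; apply: distributional_bound0.
have [kappa [enc dom]] := encoder_psi1 R r.
rewrite exprSr invfM; apply: distributional_bound_reduction IH => //.
by exists {ffun 'I_(3 ^ r) -> letter}, (@psi1_sub r), kappa.
Qed.

Variable k : nat.
Let a := alpha R k.

Lemma distributional_bound_alpha r m :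
  distributional_bound (2 ^- r / a ^+ m) (@min_query R (r + m * k)).
Proof.
elim: m => [|m IH].
  by rewrite mul0n addn0 divr1; apply: distributional_bound_half.
rewrite mulSnr addnA exprSr invfM mulrA.
apply: distributional_bound_reduction IH; first exact: alpha_gt0.
exact: reduction_alpha.
Qed.

(** By [alpha_le], the power [1 - r / k] of [a] is at most [2 ^ (k - r)]. The factor [a / 2 ^+ k] of
    the theorem thus pays for the [r] levels left over. *)
Lemma alpha_powR_le r : (0 < k)%N -> (r <= k)%N ->
  a / 2 ^+ k * a `^ (- (r%:R / k%:R)) <= 2 ^- r.
Proof.
move=> k0 rk; have a0 : 0 < a by exact: alpha_gt0.
have kR : k%:R != 0 :> R by rewrite pnatr_eq0 -lt0n.
have p0 : 0 <= 1 - r%:R / k%:R :> R.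
  by rewrite subr_ge0 ler_pdivrMr ?ltr0n // mul1r ler_nat.
have powR_a x : a * a `^ (- x) = a `^ (1 - x).
  by rewrite powRD ?powRr1 ?(ltW a0) ?(gt_eqF a0) ?implybT.
rewrite mulrAC powR_a.
rewrite ler_pdivrMr ?exprn_gt0 //.
apply: le_trans (ge0_ler_powR p0 _ _ (alpha_le R k)) _;
  rewrite ?nnegrE ?exprn_ge0 ?(ltW a0) //.
rewrite -powR_mulrn // -powRrM mulrBr mulr1 mulrCA divff // mulr1.
by rewrite powRB ?pnatr_eq0 ?implybT // !powR_mulrn // mulrC.
Qed.

Lemma distributional_bound_min_query h : (0 < k)%N ->
  distributional_bound (a / 2 ^+ k * (a `^ (- k%:R^-1)) ^+ h) (@min_query R h).
Proof.
move=> k0; have a0 : 0 < a by exact: alpha_gt0.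
have kR : k%:R != 0 :> R by rewrite pnatr_eq0 -lt0n.
have := @distributional_bound_alpha (h %% k)%N (h %/ k)%N.
rewrite addnC -divn_eq; apply: distributional_bound_le.
  by move=> t x; apply: min_query_ge0.
rewrite !mulr_ge0 ?invr_ge0 ?exprn_ge0 ?powR_ge0 ?(ltW a0) //=.
have qk : a `^ (- k%:R^-1) ^+ k = a^-1.
  by rewrite -powR_mulrn ?powR_ge0 // -powRrM mulNr mulVf // powR_inv1 // ltW.
rewrite {1}(divn_eq h k) mulnC exprD exprM qk exprVn mulrCA mulrC.
rewrite ler_pM2r ?invr_gt0 ?exprn_gt0 //.
apply: le_trans (alpha_powR_le k0 (ltnW (ltn_pmod h k0))).
by rewrite -powR_mulrn ?powR_ge0 // -powRrM mulNr [_^-1 * _]mulrC.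
Qed.
End Bounds.

(** * From the minority probability to the cost *)

Section Cost.
Variable R : realType.

(** Induction on the number [e] of levels below depth [d]: the hypothesis at [d.+1] contributes a
    factor [q], and the one at [d], through the insertion of ratio 1/2, a factor 2. *)
Lemma distributional_bound_below (c q : R) :
  0 <= c -> 0 <= q ->
  (forall h, distributional_bound (c * q ^+ h) (@min_query R h)) ->
  forall e d,
    distributional_bound (c * q ^+ d * (2 + q) ^+ e) (@below_queries R d (d + e)).
Proof.
move=> c0 q0 B; elim=> [|e IH] d.
  by rewrite addn0 expr0 mulr1 below_queries_full; apply: B.
move=> t.
have h2 : (0 : R) < 2^-1 by rewrite invr_gt0.
have := IH d.+1; rewrite addSnnS => /(_ t) B1.
have := distributional_bound_reduction h2 (reduction_insert R (leq_addr e d)) (IH d).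
rewrite -addnS => /(_ t); rewrite invrK => B2.
have := lerD B2 B1; rewrite -mulrDl -big_split /=.
under [X in _ <= X]eq_bigr do rewrite subrK.
apply: le_trans.
by rewrite le_eqVlt; apply/orP; left; apply/eqP; rewrite !exprS; ring.
Qed.

Lemma below_queries_le_cost h (t : dtree (3 ^ h)) (x : inp h) :
  below_queries R 0 t x <= (cost t x)%:R.
Proof.
rewrite /below_queries -natr_sum ler_nat.
apply: leq_trans (card_size (queries t x)); rewrite -sum1_card [leqRHS]big_mkcond /=.
by apply: leq_sum => q _; case: ifP.
Qed.

End Cost.

Lemma hard_val_ex h b : exists x : inp h, hard_val b x.
Proof.
elim: h b => [|h IH] b; first by exists (const_inp b); rewrite hard_val0.
have [w Hw] := IH (~~ b); have [u Hu] := IH b.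
exists (arr 0 w u u); rewrite hard_val_arr; first by rewrite Hw Hu.
by case/andP: Hw => _ /eqP.
Qed.

Lemma hard_inputs_gt0 h : (0 < #|hard_inputs h|)%N.
Proof.
have [x /andP[Hx _]] := hard_val_ex h true.
by apply/card_gt0P; exists x; rewrite inE.
Qed.

(** * From deterministic trees to randomized algorithms *)

Section Expectation.
Variables (R : realType) (h : nat) (P : randomized R (3 ^ h)).
Let H := hard_inputs h.

Lemma expectation_unif_mean (S : stat R h) :
  (forall t x, 0 <= S t x) ->
  ('E_P[fun t => unif_mean H (S t)]
   = (#|H|%:R^-1)%:E * \sum_(x in H) 'E_P[fun t => S t x])%E.
Proof.
move=> S0; rewrite unlock.
under eq_integral => t _ do rewrite /unif_mean mulrC EFinM -sumEFin.
rewrite ge0_integralZl_EFin ?invr_ge0 ?ler0n //; last first.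
- by move=> t _; apply: sume_ge0 => x _; rewrite lee_fin.
congr (_ * _)%E.
under eq_integral => t _ do rewrite big_mkcond.
rewrite ge0_integral_sum //; last by move=> x t _; case: ifP => // _; rewrite lee_fin.
rewrite [RHS]big_mkcond; apply: eq_bigr => x _; case: ifP => // _.
by rewrite integral0.
Qed.

(** The error term is moved to the right so that only nonnegative functions are integrated. *)
Lemma unif_mean_bound (c : R) (S : stat R h) t :
  0 <= c -> distributional_bound c S ->
  c <= unif_mean H (S t) + 2 * c * unif_mean H (error R t).
Proof.
move=> c0 /(_ t); have n0 : 0 < #|H|%:R :> R by rewrite ltr0n hard_inputs_gt0.
have inH (F : inp h -> R) : \sum_(x in H) F x = \sum_(x | hard x) F x.
  by apply: eq_bigl => x; rewrite inE.
have nE : \sum_(x : inp h | hard x) 1 = #|H|%:R :> R.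
  by have := inH (fun=> 1); rewrite sumr_const => <-.
rewrite sumrB nE -mulr_sumr /unif_mean !inH mulrA -mulrDl ler_pdivlMr // => B.
lra.
Qed.

End Expectation.

Section Yao.
Variables (R : realType) (h : nat) (P : randomized R (3 ^ h)) (delta : R).
Hypothesis Pdelta : computes_with_error P (@maj h) delta.
Let H := hard_inputs h.

Lemma expectation_bound (c : R) (S : stat R h) :
  0 <= c -> (forall t x, 0 <= S t x) -> distributional_bound c S ->
  ((c * (1 - 2 * delta))%:E <= 'E_P[fun t => unif_mean H (S t)])%E.
Proof.
move=> c0 S0 B; have n0 : 0 < #|H|%:R :> R by rewrite ltr0n hard_inputs_gt0.
have e0 t x : 0 <= error R t x :> R by exact: ler0n.
have um0 (T : stat R h) t : (forall t x, 0 <= T t x) -> 0 <= unif_mean H (T t).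
  by move=> T0; apply: divr_ge0; [exact: sumr_ge0 | exact: ltW].
have Eerr : ('E_P[fun t => unif_mean H (error R t)] <= delta%:E)%E.
  rewrite expectation_unif_mean //.
  apply: (@le_trans _ _ ((#|H|%:R^-1)%:E * \sum_(x in H) delta%:E)%E).
    rewrite lee_pmul2l ?lte_fin ?invr_gt0 // lee_sum // => x _.
    apply: le_trans (Pdelta x).
    rewrite unlock -(setIT [set t | _]%classic) -integral_indic //.
    rewrite le_eqVlt; apply/orP; left; apply/eqP; apply: eq_integral => t _.
    rewrite indicE /error; congr (nat_of_bool _)%:R%:E.
    by apply/idP/idP; rewrite inE.
  by rewrite sumEFin sumr_const -EFinM lee_fin -[delta *+ _]mulr_natl mulKf ?gt_eqF.
have : (c%:E <= 'E_P[fun t => unif_mean H (S t)]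
              + (2 * c)%:E * 'E_P[fun t => unif_mean H (error R t)])%E.
  rewrite unlock -ge0_integralZl_EFin //; last 2 first.
  - by move=> t _; rewrite lee_fin um0.
  - by rewrite mulr_ge0.
  rewrite -ge0_integralD //; last 2 first.
  - by move=> t _; rewrite lee_fin um0.
  - by move=> t _; rewrite -EFinM lee_fin mulr_ge0 ?um0 ?mulr_ge0.
  rewrite -[leLHS](_ : \int[P]_t c%:E = c%:E)%E; last first.
    by rewrite integral_cst // [X in (_ * X)%E]probability_setT mule1.
  apply: ge0_le_integral => // t _.
  by rewrite -EFinM -EFinD lee_fin unif_mean_bound.
move=> /le_trans/(_ (leeD2l _ (lee_wpmul2l _ Eerr))).
rewrite lee_fin mulr_ge0 // => /(_ isT).
rewrite -EFinM -leeBlDr // -EFinB; apply: le_trans.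
by rewrite lee_fin; lra.
Qed.

End Yao.

Lemma unif_mean_le_max_cost (R : realType) h (P : randomized R (3 ^ h)) :
  ('E_P[fun t => unif_mean (hard_inputs h) (below_queries R 0 t)] <= max_cost P)%E.
Proof.
have n0 : 0 < #|hard_inputs h|%:R :> R by rewrite ltr0n hard_inputs_gt0.
have b0 t x : 0 <= @below_queries R 0 h t x by apply: sumr_ge0.
have Ele x : ('E_P[fun t => below_queries R 0 t x] <= max_cost P)%E.
  apply: (@le_trans _ _ ('E_P[fun t => (cost t x)%:R])%E); last exact: le_bigmax.
  rewrite unlock; apply: ge0_le_integral => // t _; rewrite lee_fin //.
  exact: below_queries_le_cost.
have M0 : (0 <= max_cost P)%E.
  by apply: le_trans (Ele [ffun=> true]); apply: expectation_ge0.
rewrite expectation_unif_mean //.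
apply: (@le_trans _ _ ((#|hard_inputs h|%:R^-1)%:E
                         * \sum_(x in hard_inputs h) max_cost P)%E).
  by rewrite lee_pmul2l ?lte_fin ?invr_gt0 // lee_sum.
(* The maximal cost may be infinite. *)
move: (max_cost P) M0 => [m _|_|//]; last exact: leey.
by rewrite sumEFin sumr_const -EFinM lee_fin -[m *+ _]mulr_natl mulKf ?gt_eqF.
Qed.

Theorem theorem4 (R : realType) (k h : nat) (delta : R)
    (k_gt0 : (0 < k)%N) (delta_ge0 : 0 <= delta) :
  (((1 - 2 * delta) * (alpha R k / 2 ^+ k) * alpha R k `^ (- (h%:R / k%:R)))%:E
     <= min_minority_query_prob h delta)%E
  /\
  (((1 - 2 * delta) * (alpha R k / 2 ^+ k)
      * (2 + alpha R k `^ (- (k%:R)^-1)) ^+ h)%:E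
     <= rand_complexity delta (@maj h))%E.
Proof.
pose q := alpha R k `^ (- k%:R^-1); pose c := alpha R k / 2 ^+ k.
have q0 : 0 <= q by apply: powR_ge0.
have c0 : 0 <= c by rewrite divr_ge0 ?exprn_ge0 // ltW // alpha_gt0.
have B h' : distributional_bound (c * q ^+ h') (@min_query R h').
  exact: distributional_bound_min_query.
split; apply: le_ereal_inf_tmp => _ [P HP <-].
  rewrite -mulrA mulrC.
  rewrite (_ : alpha R k `^ _ = q ^+ h); last first.
    by rewrite -powR_mulrn // -powRrM mulNr [_^-1 * _]mulrC.
  apply: (expectation_bound HP _ (@min_query_ge0 R h) (B h)).
  by rewrite mulr_ge0 ?exprn_ge0.
rewrite -mulrA mulrC; apply: le_trans (unif_mean_le_max_cost P).
apply: (expectation_bound HP).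
- by rewrite mulr_ge0 ?exprn_ge0 ?addr_ge0.
- by move=> t x; apply: sumr_ge0.
(* At depth 0 all queried leaves count, and all [h] levels contribute a factor [2 + q]. *)
- have := @distributional_bound_below R c q c0 q0 B h 0.
  by rewrite expr0 mulr1.
Qed.
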